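(* Let $r,k,e$ be fixed integers with $r\ge k+1\ge e\ge 3$. Then $f_r(n,e(r-k)+k+1,e)=o(n^k)$ as $n\to\infty$.
   Context: For integers $r,v,e$, an $r$-uniform hypergraph is called $\mathcal{G}_r(v,e)$-free if it does not contain $e$ distinct edges whose union has at most $v$ vertices (equivalently, the union of any $e$ distinct edges has at least $v+1$ vertices). $f_r(n,v,e)$ denotes the maximum number of edges in a $\mathcal{G}_r(v,e)$-free $r$-uniform hypergraph on $n$ vertices. *)

(* Defs.v *)
From mathcomp Require Import all_boot.

Set Implicit Arguments.
Unset Strict Implicit.
Unset Printing Implicit Defensive.

(* A hypergraph on the vertex set T is identified with its set of edges. *)
Definition uniform (T : finType) (r : nat) (H : {set {set T}}) : bool :=
  [forall E in H, #|E| == r].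

Definition Gfree (T : finType) (v e : nat) (H : {set {set T}}) : bool :=
  ~~ [exists S : {set {set T}},
        [&& S \subset H, #|S| == e & #|\bigcup_(E in S) E| <= v]].

(* For 0 < e the edgeless hypergraph is admissible, so this is the maximum of
   a nonempty family; for e = 0 no hypergraph is and the value is 0. *)
Definition ex_edges (r n v e : nat) : nat :=
  \max_(H : {set {set 'I_n}} | uniform r H && Gfree v e H) #|H|.

(* Main.v *)
Require Import Defs.
From mathcomp Require Import all_boot all_order all_algebra.
From mathcomp Require Import all_classical all_reals all_analysis.
From mathcomp Require Import ring lra.
Import Order.TTheory GRing.Theory Num.Theory numFieldNormedType.Exports.
Local Open Scope ring_scope.

Set Implicit Arguments.
Unset Strict Implicit.
Unset Printing Implicit Defensive.

(** Pass to an ultrafilter along which a counterexample has positive density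
    and work with sequences of functions on [X_t ^ J], where [J] has [k + 1]
    elements.  The first [k + 1] vertices of an edge give a point of [X_t ^ J],
    and freeness makes the uniform measure [N] on these points, suitably
    scaled, at most the uniform measure on every function of only [k]
    coordinates.  A function of the coordinates in [g] has a conditional
    expectation on the algebra generated by sets depending on fewer than [j]
    coordinates; by Fubini these conditional expectations factor over products,
    as if the different coordinate sets were independent.  By induction on
    [j], if [N] gives positive mass to a product of functions, each depending on
    at most [k] coordinates and measurable in that algebra, then so does the
    uniform measure; for the indicators of the faces of edges and [j = k + 1]
    this is a form of the simplex removal lemma.  Hence there are about
    [n ^ (k + 1)] points all of whose faces come from edges, while only
    [O (n ^ k)] of them have all their coordinates in a single edge.  Any other
    such point yields [k + 1] distinct edges each meeting it in [k] vertices, and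
    [e] of these span at most [e (r - k) + k + 1] vertices. *)

(** * Averages and sums *)

Section FiniteSums.
Context {R : realType}.

Lemma sum_pred1 (T : finType) (y : T) (F : T -> R) :
  \sum_k (y == k)%:R * F k = F y.
Proof.
rewrite (bigD1 y)//= eqxx mul1r big1 ?addr0// => i /negbTE.
by rewrite eq_sym => ->; rewrite mul0r.
Qed.

Lemma sum_pred1_1 (T : finType) (y : T) : \sum_k (y == k)%:R = 1 :> R.
Proof.
rewrite -[RHS](sum_pred1 y (fun=> 1)).
by apply: eq_bigr => k _; rewrite mulr1.
Qed.

Lemma prod_bool (T : Type) (r : seq T) (p : T -> bool) :
  \prod_(g <- r) (p g)%:R = (all p r)%:R :> R.
Proof.
elim: r => [|g r IH]; first by rewrite big_nil.
by rewrite big_cons IH /=; case: (p g); rewrite ?mul1r ?mul0r.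
Qed.

End FiniteSums.

Section WeightedSum.
Context {R : realType} {V : finType}.
Implicit Types (w f g : V -> R).

Definition wsum w f : R := \sum_x w x * f x.

Lemma eq_wsum w f g : f =1 g -> wsum w f = wsum w g.
Proof. by move=> fg; apply: eq_bigr => x _; rewrite fg. Qed.

Lemma wsumD w f g : wsum w (fun x => f x + g x) = wsum w f + wsum w g.
Proof. by rewrite -big_split; apply: eq_bigr => x _; rewrite mulrDr. Qed.

Lemma wsumZ w c f : wsum w (fun x => c * f x) = c * wsum w f.
Proof. by rewrite mulr_sumr; apply: eq_bigr => x _; rewrite mulrCA. Qed.

Lemma wsumN w f : wsum w (fun x => - f x) = - wsum w f.
Proof. by rewrite /wsum -sumrN; apply: eq_bigr => x _; rewrite mulrN. Qed.

Lemma wsumB w f g : wsum w (fun x => f x - g x) = wsum w f - wsum w g.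
Proof. by rewrite wsumD wsumN. Qed.

Lemma wsum_sum (I : Type) (r : seq I) (P : pred I) (F : I -> V -> R) w :
  wsum w (fun x => \sum_(i <- r | P i) F i x) = \sum_(i <- r | P i) wsum w (F i).
Proof.
by rewrite /wsum exchange_big /=; apply: eq_bigr => x _; rewrite mulr_sumr.
Qed.

Lemma wsum_le w f g : (forall x, 0 <= w x) -> (forall x, f x <= g x) ->
  wsum w f <= wsum w g.
Proof. by move=> w0 fg; apply: ler_sum => x _; exact: ler_wpM2l. Qed.

Lemma wsum_ge0 w f : (forall x, 0 <= w x) -> (forall x, 0 <= f x) ->
  0 <= wsum w f.
Proof. by move=> w0 f0; apply: sumr_ge0 => x _; exact: mulr_ge0. Qed.

Lemma ler_norm_wsum w f : (forall x, 0 <= w x) ->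
  `|wsum w f| <= wsum w (fun x => `|f x|).
Proof.
move=> w0; apply: le_trans (ler_norm_sum _ _ _) _.
by apply: ler_sum => x _; rewrite normrM ger0_norm.
Qed.

(** A special [wsum], so the lemmas above apply to it. Over an empty type it is 0, since the inverse
    of 0 is 0. *)
Definition avg f : R := wsum (fun=> #|V|%:R^-1) f.

Lemma avg_weight_ge0 (x : V) : 0 <= #|V|%:R^-1 :> R.
Proof. by rewrite invr_ge0. Qed.

Lemma avgE f : avg f = #|V|%:R^-1 * \sum_x f x.
Proof. by rewrite /avg /wsum mulr_sumr. Qed.

Lemma eq_avg f g : f =1 g -> avg f = avg g.
Proof. exact: eq_wsum. Qed.

Lemma avg_cst (c : R) : (0 < #|V|)%N -> avg (fun=> c) = c.
Proof.
move=> V0; rewrite avgE sumr_const -[c *+ _]mulr_natl mulrA mulVf ?mul1r//.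
by rewrite pnatr_eq0 -lt0n.
Qed.

Lemma avg_le f g : (forall x, f x <= g x) -> avg f <= avg g.
Proof. exact/wsum_le/avg_weight_ge0. Qed.

Lemma avg_ge0 f : (forall x, 0 <= f x) -> 0 <= avg f.
Proof. exact/wsum_ge0/avg_weight_ge0. Qed.

Lemma ler_norm_avg f : `|avg f| <= avg (fun x => `|f x|).
Proof. exact/ler_norm_wsum/avg_weight_ge0. Qed.

End WeightedSum.

(** * Conditional expectation on a finite partition *)

Section CellAverage.
Context {R : realType} {V K : finType} (key : V -> K).
Implicit Types (f s : V -> R).

Definition cell_size (x : V) : R := \sum_(y | key y == key x) 1.

Definition cell_avg f (x : V) : R :=
  (\sum_(y | key y == key x) f y) / cell_size x.

Lemma cell_size_gt0 x : 0 < cell_size x.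
Proof.
rewrite /cell_size (bigD1 x) //= ltr_pwDl ?ltr01//.
by apply: sumr_ge0 => *; exact: ler01.
Qed.

Lemma cell_avg_cell f x y : key x = key y -> cell_avg f x = cell_avg f y.
Proof. by rewrite /cell_avg /cell_size => ->. Qed.

Lemma cell_avg_in01 f x : (forall y, 0 <= f y <= 1) -> 0 <= cell_avg f x <= 1.
Proof.
move=> f01; rewrite ler_pdivlMr ?ler_pdivrMr ?cell_size_gt0// mul0r mul1r.
apply/andP; split; first by apply: sumr_ge0 => y _; case/andP: (f01 y).
by apply: ler_sum => y _; case/andP: (f01 y).
Qed.

(** After exchanging the sums, each [y] receives a share [1 / cell_size y] from every point of its
    cell, and these shares add up to 1; [s] follows because it is constant on cells. *)
Lemma avg_cell_avg f s : (forall x y, key x = key y -> s x = s y) ->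
  avg (fun x => cell_avg f x * s x) = avg (fun x => f x * s x).
Proof.
move=> scell; rewrite !avgE; congr (_ * _).
under eq_bigr => x _ do rewrite /cell_avg -mulrA mulr_suml.
rewrite (exchange_big_dep xpredT) //=; apply: eq_bigr => y _.
rewrite -mulr_sumr; congr (_ * _).
under eq_bigr => x /eqP xy do
  rewrite -(scell _ _ xy) /cell_size -xy -/(cell_size y) -[_^-1]mul1r -mulrA.
rewrite -mulr_suml.
rewrite (eq_bigl (fun x => key x == key y)) => [|x]; last by rewrite eq_sym.
by rewrite -/(cell_size y) mulrA divff ?mul1r// gt_eqF// cell_size_gt0.
Qed.

Lemma avg_sub_cell_avg f s : (forall x y, key x = key y -> s x = s y) ->
  avg (fun x => (f x - cell_avg f x) * s x) = 0.
Proof.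
move=> /(avg_cell_avg f) fs; apply/eqP.
rewrite /avg (@eq_wsum _ _ _ _ (fun x => f x * s x - cell_avg f x * s x)).
  by rewrite wsumB subr_eq0 -/(avg _) -fs.
by move=> x; rewrite mulrBl.
Qed.

End CellAverage.

(** * Simplices in a hypergraph *)

Section Hypergraph.
Variables (m r k e : nat) (H : {set {set 'I_m.+1}}).
Hypotheses (kr : (k < r)%N) (ek : (e <= k.+1)%N) (e0 : (0 < e)%N).
Hypothesis H_uniform : uniform r H.
Hypothesis H_free : Gfree (e * (r - k) + k + 1) e H.

Local Notation V := {ffun 'I_k.+1 -> 'I_m.+1}.
Implicit Types (E F : {set 'I_m.+1}) (x : V) (s : {set 'I_k.+1}).

(** The order of [enum] turns an edge into a single point. The default [ord0] is never reached on
    edges of [H], since [k < r]. *)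
Definition tup E : V := [ffun i : 'I_k.+1 => nth ord0 (enum E) i].

Lemma card_edge E : E \in H -> #|E| = r.
Proof. by move: H_uniform => /forall_inP HH /HH /eqP. Qed.

Lemma tup_in E i : E \in H -> tup E i \in E.
Proof.
move=> /card_edge Er; rewrite ffunE -mem_enum mem_nth// -cardE Er.
exact: leq_trans (ltn_ord i) kr.
Qed.

Lemma tup_inj E : E \in H -> injective (tup E).
Proof.
move=> /card_edge Er i j; rewrite !ffunE => /eqP.
have lt_size (l : 'I_k.+1) : (l < size (enum E))%N.
  by rewrite -cardE Er; exact: leq_trans (ltn_ord l) kr.
by rewrite nth_uniq ?enum_uniq// => /eqP/val_inj.
Qed.

Lemma card_bigcup_through (Y : {set 'I_m.+1}) (S : {set {set 'I_m.+1}}) b :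
  (forall E, E \in S -> #|E :\: Y| <= b)%N ->
  (#|\bigcup_(E in S) E| <= #|Y| + #|S| * b)%N.
Proof.
move=> Sb; apply: (@leq_trans #|Y :|: \bigcup_(E in S) (E :\: Y)|).
  apply/subset_leq_card/bigcupsP => E ES; apply/fintype.subsetP => u uE.
  rewrite inE; case: (boolP (u \in Y)) => //= uY; apply/finset.bigcupP; exists E => //.
  by rewrite inE uY.
rewrite cardsU; apply: leq_trans (leq_subr _ _) _; rewrite leq_add2l.
apply: (@leq_trans (\sum_(E in S) #|E :\: Y|)).
  elim/big_rec2 : _ => [|E p q _ IH]; first by rewrite cards0.
  by rewrite cardsU; apply: leq_trans (leq_subr _ _) _; rewrite leq_add2l.
by rewrite -sum_nat_const; exact: leq_sum.
Qed.

Lemma Gfree_sub (S : {set {set 'I_m.+1}}) : S \subset H -> #|S| = e ->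
  (e * (r - k) + k + 1 < #|\bigcup_(E in S) E|)%N.
Proof.
move=> SH Se; rewrite ltnNge; apply/negP => le_S; move: H_free; rewrite /Gfree.
by move/negP; apply; apply/existsP; exists S; rewrite SH Se eqxx.
Qed.

Lemma exists_subset_card (T : finType) (A : {set T}) b : (b <= #|A|)%N ->
  exists2 S : {set T}, S \subset A & #|S| = b.
Proof.
move=> bA; exists [set u in take b (enum A)].
  by apply/fintype.subsetP => u; rewrite inE => /mem_take; rewrite mem_enum.
rewrite cardsE (card_uniqP _) ?size_takel -?cardE//.
by rewrite take_uniq// enum_uniq.
Qed.

(** Each edge through [Y] adds at most [r - k] vertices, so [e] of them span at most
    [k + e * (r - k)], one below the bound excluded by freeness. *)
Lemma codegree (Y : {set 'I_m.+1}) : #|Y| = k ->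
  (#|[set E in H | Y \subset E]| < e)%N.
Proof.
move=> Yk; rewrite ltnNge; apply/negP => /exists_subset_card [S SH Se].
have SH' : S \subset H.
  by apply: fintype.subset_trans SH _; apply/fintype.subsetP => E; rewrite inE => /andP[].
have := Gfree_sub SH' Se; rewrite ltnNge => /negP; apply.
have := @card_bigcup_through Y S (r - k)%N; rewrite Yk Se => le_S.
apply: leq_trans (le_S _) _; last by rewrite addnC -addnA leq_add2l leq_addr.
move=> E /(fintype.subsetP SH); rewrite inE => /andP[EH YE].
by rewrite cardsD (card_edge EH) (finset.setIidPr YE) Yk.
Qed.

Definition face s x : bool := [exists E in H, [forall l in s, tup E l == x l]].

Lemma face_dep s x (y : V) : {in s, x =1 y} -> face s x = face s y.
Proof.
move=> xy; apply: eq_existsb => E; congr andb; apply: eq_forallb => l.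
by case: (boolP (l \in s)) => //= /xy ->.
Qed.

Lemma face_tup s E : E \in H -> face s (tup E).
Proof. by move=> EH; apply/existsP; exists E; rewrite EH; apply/forall_inP. Qed.

Definition degenerate x : bool := [exists E in H, [forall l, x l \in E]].

(** The points left over after this count have distinct edges through their faces. *)
Lemma card_degenerate : (#|[set x | degenerate x]| <= #|H| * r ^ k.+1)%N.
Proof.
apply: (@leq_trans #|\bigcup_(E in H) [set x : V | [forall l, x l \in E]]|).
  apply/subset_leq_card/fintype.subsetP => x; rewrite inE => /exists_inP[E EH xE].
  by apply/finset.bigcupP; exists E => //; rewrite inE.
apply: (@leq_trans (\sum_(E in H) #|[set x : V | [forall l, x l \in E]]|)).
  elim/big_rec2 : _ => [|E p q _ IH]; first by rewrite cards0.
  by rewrite cardsU; apply: leq_trans (leq_subr _ _) _; rewrite leq_add2l.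
rewrite -sum_nat_const; apply: leq_sum => E EH.
rewrite -(card_edge EH) -[k.+1 in leqRHS]card_ord -card_ffun_on cardsE.
apply/subset_leq_card/fintype.subsetP => x; rewrite inE => /forallP xE.
by apply/ffun_onP => l; exact: xE.
Qed.

Lemma no_simplex x : (forall s, s != [set: 'I_k.+1] -> face s x) -> degenerate x.
Proof.
move=> Hx; apply: contrapT => ndeg.
have /fin_all_exists [F HF] i : exists E, E \in H /\ forall l, l != i -> tup E l = x l.
  have : face [set~ i] x.
    by apply: Hx; apply/negP => /eqP/setP /(_ i); rewrite !inE eqxx.
  move=> /exists_inP[E EH /forall_inP HE]; exists E; split=> // l li.
  by apply/eqP/HE; rewrite !inE.
have Fin i : F i \in H by case: (HF i).
have xF i l : l != i -> x l \in F i.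
  by case: (HF i) => _ h /h <-; exact: tup_in.
(* If two of these edges coincided, the common edge would contain every coordinate of [x]. *)
have Finj : injective F.
  move=> i j Fij; apply/eqP; apply: contrapT => /negP ij; apply: ndeg.
  apply/exists_inP; exists (F i) => //; apply/forallP => l.
  by have [->|/xF//] := eqVneq l i; rewrite Fij; exact: xF.
have [I _ Ie] : exists2 I : {set 'I_k.+1}, I \subset [set: 'I_k.+1] & #|I| = e.
  by apply: exists_subset_card; rewrite cardsT card_ord.
pose S := [set F i | i in I]; pose Y := [set x l | l in 'I_k.+1].
have Se : #|S| = e by rewrite card_imset.
have SH : S \subset H by apply/fintype.subsetP => E /imsetP[i _ ->].
have := Gfree_sub SH Se; rewrite ltnNge => /negP; apply.
have Yk : (#|Y| <= k.+1)%N by rewrite -[leqRHS]card_ord; exact: leq_imset_card.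
apply: leq_trans (@card_bigcup_through Y S (r - k)%N _) _; last first.
  by rewrite Se addnC -addnA leq_add2l addn1.
move=> E /imsetP[i _ ->]; rewrite cardsD (card_edge (Fin i)) leq_sub2l//.
(* The vertices [tup (F i) l] with [l != i] are [k] distinct coordinates of [x], so at most [r - k]
   vertices of [F i] lie outside [Y]. *)
have <- : #|[set tup (F i) l | l in [set~ i]]| = k.
  by rewrite card_imset ?cardsC1 ?card_ord//; exact: tup_inj.
apply/subset_leq_card/fintype.subsetP => u /imsetP[l]; rewrite !inE => li ->.
rewrite tup_in//=; have [_ ->//] := HF i.
by apply/imsetP; exists l.
Qed.

(** * The measure carried by the edges *)

Section Weight.
Context {R : realType}.

(** The scaling is dictated by [codegree]: with fewer than [e] edges through any [k] vertices, it
    makes the uniform measure dominate. The total mass is proportional to [#|H|] and is not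
    normalised to 1. *)
Definition edge_weight x : R := (\sum_(E in H) (tup E == x)%:R) / (e%:R * m.+1%:R ^+ k).

Lemma denom_gt0 : 0 < e%:R * m.+1%:R ^+ k :> R.
Proof. by rewrite mulr_gt0 ?exprn_gt0 ?ltr0n. Qed.

Lemma edge_weight_ge0 x : 0 <= edge_weight x.
Proof. by apply: divr_ge0; [exact: sumr_ge0|exact/ltW/denom_gt0]. Qed.

Lemma wsum_edge_weight (f : V -> R) :
  wsum edge_weight f = (\sum_(E in H) f (tup E)) / (e%:R * m.+1%:R ^+ k).
Proof.
rewrite /wsum /edge_weight; under eq_bigr => x _ do rewrite mulrAC mulr_suml.
rewrite -mulr_suml exchange_big /=; congr (_ / _); apply: eq_bigr => E _.
exact: sum_pred1.
Qed.

Lemma edge_weight_dom s (f : V -> R) : s != [set: 'I_k.+1] ->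
  (forall x, 0 <= f x) -> (forall x y : V, {in s, x =1 y} -> f x = f y) ->
  wsum edge_weight f <= avg f.
Proof.
move=> sT f0 fs.
have [i is_] : exists i, i \notin s.
  apply/existsP; apply: contraT; rewrite negb_exists => /forallP h.
  by case/negP: sT; apply/eqP/setP => l; rewrite inE; apply/negPn/h.
pose upd x (y : 'I_m.+1) : V := [ffun l => if l == i then y else x l].
have fupd x y : f (upd x y) = f x.
  by apply: fs => l ls; rewrite ffunE; case: eqP ls => // ->; rewrite (negbTE is_).
(* Moving the free coordinate [i] covers each [x] less than [e] times. *)
have main : m.+1%:R * (\sum_(E in H) f (tup E)) <= e%:R * \sum_x f x.
  have -> : m.+1%:R * (\sum_(E in H) f (tup E)) =
      \sum_x f x * \sum_(E in H) \sum_y (upd (tup E) y == x)%:R.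
    under [RHS]eq_bigr => x _ do rewrite mulr_sumr.
    rewrite exchange_big mulr_sumr /=; apply: eq_bigr => E _.
    under [RHS]eq_bigr => x _ do rewrite mulr_sumr.
    rewrite exchange_big /=.
    under [RHS]eq_bigr => y _.
      under eq_bigr => x _ do rewrite mulrC.
      rewrite sum_pred1 fupd.
      over.
    by rewrite sumr_const card_ord mulr_natl.
  rewrite mulr_sumr; apply: ler_sum => x _; rewrite mulrC ler_wpM2r//.
  pose B := [set E in H | [forall l, (l != i) ==> (tup E l == x l)]].
  apply: (@le_trans _ _ (\sum_(E in H) (E \in B)%:R)).
    apply: ler_sum => E EH; rewrite inE EH /=.
    have [/forallP h|/negP h] := boolP [forall l, (l != i) ==> (tup E l == x l)].
      rewrite (bigD1 (x i))//= big1 ?addr0 ?lern1 ?leq_b1// => y yx.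
      rewrite (_ : _ == _ = false)//; apply/negP => /eqP/ffunP /(_ i).
      by rewrite ffunE eqxx => /eqP; rewrite (negbTE yx).
    rewrite big1// => y _; case: eqP => // ux; case: h; apply/forallP => l.
    by apply/implyP => li; rewrite -ux [X in _ == X]ffunE (negbTE li).
  rewrite -natr_sum ler_nat.
  have -> : (\sum_(E in H) (E \in B) = #|B|)%N.
    rewrite -sum1_card big_mkcond [RHS]big_mkcond /=; apply: eq_bigr => E _.
    by rewrite inE; case: (E \in H); case: [forall _, _].
  (* For an arbitrary [x] the vertices [x l] with [l != i] may repeat; an edge [E0] in [B] rules
     this out, since they are then entries of [tup E0]. *)
  have [->|[E0]] := set_0Vmem B; first by rewrite cards0.
  rewrite inE => /andP[E0H /forallP E0x].
  pose Y := [set x l | l in [set~ i]].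
  have Yk : #|Y| = k.
    rewrite card_in_imset ?cardsC1 ?card_ord// => l l'; rewrite !inE => li l'i.
    have := E0x l; have := E0x l'; rewrite li l'i /= => /eqP <- /eqP <-.
    exact: tup_inj.
  apply: leq_trans (ltnW (codegree Yk)); apply/subset_leq_card/fintype.subsetP => E.
  rewrite !inE => /andP[EH /forallP Ex]; rewrite EH /=.
  apply/fintype.subsetP => u /imsetP[l]; rewrite !inE => li ->.
  by have := Ex l; rewrite li /= => /eqP <-; exact: tup_in.
have N0 : 0 < m.+1%:R :> R by rewrite ltr0n.
rewrite wsum_edge_weight avgE card_ffun !card_ord ler_pdivrMr ?denom_gt0// natrX exprS.
have := exprn_gt0 k N0; move: main N0.
move: (m.+1%:R : R) (\sum_x f x) (\sum_(_ in _) _) => N S2 S1 main N0.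
move: (N ^+ k) => M M0.
rewrite (_ : _ * _ = (e%:R * S2) / N); last by field; rewrite !gt_eqF.
by rewrite ler_pdivlMr// mulrC.
Qed.

End Weight.
End Hypergraph.

Local Open Scope classical_set_scope.
Local Open Scope ring_scope.

(** * Limits along an ultrafilter and conditional expectations *)

Section Ultra.
Context {U : set_system nat} {UF : UltraFilter U}.

Lemma ultra_not (P : nat -> Prop) :
  ~ (\forall t \near U, P t) -> \forall t \near U, ~ P t.
Proof. by case: (in_ultra_setVsetC P UF). Qed.

Lemma near_forall_fin (I : finType) (P : I -> nat -> Prop) :
  (forall i, \forall t \near U, P i t) -> \forall t \near U, forall i, P i t.
Proof.
move=> H; suff : \forall t \near U, forall i, i \in enum I -> P i t.
  by apply: filterS => t Ht i; apply: Ht; rewrite mem_enum.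
elim: (enum I) => [|j s IH]; first exact: nearW.
apply: filterS2 (H j) IH => t Hj Hs i.
by rewrite inE => /orP[/eqP->|/Hs].
Qed.

(** Pigeonhole along [U]: a choice among finitely many options that varies with [t] can be made once
    for all. *)
Lemma ultra_exists_fin (I : finType) (P : I -> nat -> Prop) :
  (\forall t \near U, exists i, P i t) -> exists i, \forall t \near U, P i t.
Proof.
move=> H; apply: contrapT => nex.
have : \forall t \near U, forall i, ~ P i t.
  apply: near_forall_fin => i; apply: ultra_not => Hi; apply: nex.
  by exists i.
move=> H2; have [t [[i Hi] nH]] := filter_ex (filterI H H2).
exact: nH i Hi.
Qed.

(** A form of countable saturation: [mu t] is the largest [q <= t] such that every [D i j t] with
    [i, j <= q] holds, a condition true near [U] for each fixed [q]. *)
Lemma near_diagonal (D : nat -> nat -> nat -> Prop) :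
  (forall N, \forall t \near U, (N <= t)%N) ->
  (forall p m, \forall t \near U, D p m t) ->
  exists mu : nat -> nat, forall p, \forall t \near U, (p <= mu t)%N /\ D p (mu t) t.
Proof.
move=> Uoo DU.
pose N p t := forall i j : 'I_p.+1, D i j t.
have NU p : \forall t \near U, N p t.
  by apply: near_forall_fin => i; apply: near_forall_fin => j; exact: DU.
exists (fun t => \max_(p < t.+1 | `[< N p t >]) p)%N => p.
apply: filterS2 (Uoo p) (NU p) => t pt Npt.
have pt1 : (p < t.+1)%N by [].
have Pp : `[< N (Ordinal pt1) t >] by apply/asboolP.
have le_p : (p <= \max_(p < t.+1 | `[< N p t >]) p)%N.
  exact: (@leq_bigmax_cond _ _ (fun i : 'I_t.+1 => i : nat) _ Pp).
split=> //.
have /(eq_bigmax_cond (fun i : 'I_t.+1 => i : nat)) : (0 < #|[pred i : 'I_t.+1 | `[< N i t >]]|)%N.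
  by apply/card_gt0P; exists (Ordinal pt1).
case=> q; rewrite inE => Nq Eq.
rewrite Eq in le_p *.
have qlt : (q < q.+1)%N by [].
have plt : (p < q.+1)%N by [].
exact: (Nq (Ordinal plt) (Ordinal qlt)).
Qed.

Context {R : realType}.
Implicit Types u v : nat -> R.

Definition small u := forall e : R, 0 < e -> \forall t \near U, `|u t| <= e.

Lemma small0 : small (fun=> 0).
Proof. by move=> e e0; apply: nearW => t; rewrite normr0 ltW. Qed.

Lemma smallD u v : small u -> small v -> small (fun t => u t + v t).
Proof.
move=> su sv e e0; have e2 : 0 < e / 2 by lra.
apply: filterS2 (su _ e2) (sv _ e2) => t hu hv.
by apply: le_trans (ler_normD _ _) _; lra.
Qed.

Lemma eq_small u v : u =1 v -> small u -> small v.
Proof. by move=> uv su e /su; apply: filterS => t; rewrite uv. Qed.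

Lemma small_sum (I : finType) (F : I -> nat -> R) :
  (forall i, small (F i)) -> small (fun t => \sum_i F i t).
Proof.
move=> sF; suff : forall s : seq I, small (fun t => \sum_(i <- s) F i t).
  by apply.
elim=> [|i s IH].
  by apply: eq_small small0 => t; rewrite big_nil.
by apply: eq_small (smallD (sF i) IH) => t; rewrite big_cons.
Qed.

Lemma small_approx u :
  (forall e : R, 0 < e -> exists2 v, small v & \forall t \near U, `|u t| <= `|v t| + e) ->
  small u.
Proof.
move=> H e e0; have e2 : 0 < e / 2 by lra.
have [v sv uv] := H _ e2.
by apply: filterS2 (sv _ e2) uv => t; lra.
Qed.

End Ultra.

(** * Colorings, measurability and conditional expectation along the ultrafilter *)

Section Internal.
Context {R : realType} {J : finType} {X : nat -> finType}.
Context (U : set_system nat) {UF : UltraFilter U}.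
Hypothesis Uoo : forall N, \forall t \near U, (N <= t)%N.

Local Notation V t := {ffun J -> X t}.
Local Notation ifun := (forall t, V t -> R).
Implicit Types (phi psi s : ifun) (P Q : pred {set J}) (e g : {set J}).

(** Statements about limits are phrased as "for [U]-almost all [t]": [U] being an
    ultrafilter, no limit ever has to be taken. *)
Definition dep e {T : Type} (f : forall t, V t -> T) :=
  forall t (x y : V t), {in e, x =1 y} -> f t x = f t y.

(** The colours at [g] partition [V t] into sets depending on the coordinates in
    [g]; their number does not grow with [t]. *)
Record coloring := Coloring {
  color : finType;
  chi : {set J} -> forall t, V t -> color;
  chi_dep : forall g, dep g (chi g) }.
Implicit Types (c : coloring).

(** Colours outside [P] are masked by [None], so that the keys for all families [P] live in one
    finite type. *)
Definition key P c t (x : V t) : {ffun {set J} -> option (color c)} :=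
  [ffun g => if P g then Some (chi c g x) else None].

Definition cellwise P c s := forall t (x y : V t), key P c x = key P c y -> s t x = s t y.

Lemma key_eqP P c t (x y : V t) :
  key P c x = key P c y <-> (forall g, P g -> chi c g x = chi c g y).
Proof.
split=> [/ffunP xy g Pg|xy]; first by have := xy g; rewrite !ffunE Pg => -[].
by apply/ffunP => g; rewrite !ffunE; case: ifP => // /xy ->.
Qed.

Lemma key_sub P Q c t (x y : V t) : {subset P <= Q} ->
  key Q c x = key Q c y -> key P c x = key P c y.
Proof. by move=> PQ /key_eqP xy; apply/key_eqP => g /PQ /xy. Qed.

Lemma cellwise_sub P Q c s : {subset P <= Q} -> cellwise P c s -> cellwise Q c s.
Proof. by move=> PQ cs t x y /(key_sub PQ)/cs. Qed.

Section Merge.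
Context {I : finType} (c : I -> coloring).

(** The common refinement: the joint colour records the colours of all the given colorings. *)
Definition join_chi g t (x : V t) : {dffun forall i, color (c i)} :=
  [ffun i => chi (c i) g x].

Lemma join_chi_dep g : dep g (join_chi g).
Proof. by move=> t x y xy; apply/ffunP => i; rewrite !ffunE; exact: chi_dep. Qed.

Definition join_coloring := Coloring join_chi_dep.

Lemma key_join P i t (x y : V t) :
  key P join_coloring x = key P join_coloring y -> key P (c i) x = key P (c i) y.
Proof.
by move=> /key_eqP xy; apply/key_eqP => g /xy /ffunP /(_ i); rewrite !ffunE.
Qed.

Lemma cellwise_join P i s : cellwise P (c i) s -> cellwise P join_coloring s.
Proof. by move=> cs t x y /(@key_join P i _ _ _)/cs. Qed.

End Merge.

Definition in01 phi := forall t x, 0 <= phi t x <= 1.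

(** [phi] lies in the [L^1]-closure of the algebra generated by the sets
    depending on the coordinates in some [g] with [P g]. *)
Definition meas P phi := forall e : R, 0 < e -> exists c s,
  [/\ cellwise P c s, in01 s &
      \forall t \near U, avg (fun x => `|phi t x - s t x|) <= e].

(** Together with [meas P psi] this makes [psi] the conditional expectation of [phi] on the algebra
    attached to [P]. *)
Definition orth P phi psi := forall c s, cellwise P c s ->
  (forall t x, `|s t x| <= 1) ->
  small (U := U) (fun t => avg (fun x => (phi t x - psi t x) * s t x)).

Lemma meas_sub P Q phi : {subset P <= Q} -> meas P phi -> meas Q phi.
Proof.
move=> PQ mphi e /mphi [c [s [cs s01 near_s]]]; exists c, s; split=> //.
exact: (cellwise_sub PQ cs).
Qed.

Lemma cellwise_meas P c s : cellwise P c s -> in01 s -> meas P s.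
Proof.
move=> cs s01 e e0; exists c, s; split=> //; apply: filterE => t.
rewrite /avg (@eq_wsum _ _ _ _ (fun=> 0 * 0)) => [|x].
  by rewrite wsumZ mul0r ltW.
by rewrite subrr normr0 mulr0.
Qed.

(** Pointwise, [e * a <= e ^+ 2 + a ^+ 2] for [a] the absolute value. This passes from [L^2] to
    [L^1] without square roots. *)
Lemma avg_norm_le_sqr (T : finType) (f : T -> R) (e : R) : (0 < #|T|)%N -> 0 < e ->
  avg (fun x => `|f x|) <= e + avg (fun x => f x ^+ 2) / e.
Proof.
move=> T0 e0; have -> : e + avg (fun x => f x ^+ 2) / e =
    avg (fun x => e + e^-1 * f x ^+ 2).
  by rewrite /avg wsumD wsumZ -/(avg (fun=> e)) avg_cst// mulrC.
apply: avg_le => x; rewrite -(real_normK (num_real (f x))).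
have := normr_ge0 (f x); move: `|f x| => a a0.
rewrite -(ler_pM2l e0) mulrDr mulrA mulfV ?gt_eqF// mul1r.
nra.
Qed.

Section ConditionalExpectation.
Hypothesis V_gt0 : forall t, (0 < #|V t|)%N.
Variables (P : pred {set J}) (phi : ifun).
Arguments phi : clear implicits.
Hypothesis phi01 : in01 phi.

Let sc c : ifun := fun t x => cell_avg (@key P c t) (phi t) x.
Arguments sc : clear implicits.
Let en c t := avg (fun x => sc c t x ^+ 2).

Lemma sc01 c : in01 (sc c).
Proof. by move=> t x; exact/cell_avg_in01/phi01. Qed.

Lemma sc_cell c : cellwise P c (sc c).
Proof. by move=> t x y; exact: cell_avg_cell. Qed.

(** Pythagoras: [sc c] is constant on the cells of both colorings, so pairing it with [sc c'] or
    with itself gives the same as pairing it with [phi]. *)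
Lemma energy_increment c c' t :
  (forall x y : V t, key P c' x = key P c' y -> key P c x = key P c y) ->
  avg (fun x => (sc c' t x - sc c t x) ^+ 2) = en c' t - en c t.
Proof.
move=> c'c.
have h1 : avg (fun x => sc c' t x * sc c t x) = avg (fun x => phi t x * sc c t x).
  by apply: avg_cell_avg => x y /c'c; exact: sc_cell.
have h2 : avg (fun x => sc c t x * sc c t x) = avg (fun x => phi t x * sc c t x).
  by apply: avg_cell_avg => x y; exact: sc_cell.
have -> : avg (fun x => (sc c' t x - sc c t x) ^+ 2) = en c' t + avg (fun x =>
    (- 2) * (sc c' t x * sc c t x) + sc c t x * sc c t x).
  by rewrite /en /avg -wsumD; apply: eq_wsum => x; ring.
rewrite /avg wsumD wsumZ -!/(avg _) h1 -h2.
rewrite (_ : en c t = avg (fun x => sc c t x * sc c t x)); first by ring.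
by apply: eq_avg => x; rewrite expr2.
Qed.

(** Collecting lower bounds valid near [U] makes [sup energies] the supremum of the limiting
    energies without forming those limits. *)
Let energies : set R := [set r | exists c, \forall t \near U, r <= en c t].

Lemma en_ge0 c t : 0 <= en c t.
Proof. by apply: avg_ge0 => x; exact: sqr_ge0. Qed.

Lemma en_le1 c t : en c t <= 1.
Proof.
rewrite -[leRHS](avg_cst (V := V t) 1 (V_gt0 t)); apply: avg_le => x.
by have := @sc01 c t x; nra.
Qed.

Lemma trivial_coloring_dep g : dep g (fun t (_ : V t) => tt).
Proof. by []. Qed.

Definition trivial_coloring := Coloring trivial_coloring_dep.

Lemma energies_has_sup : has_sup energies.
Proof.
split; first by exists 0, trivial_coloring; apply: filterE => t; exact: en_ge0.
exists 1 => r [c] /filter_ex [t] /le_trans; apply; exact: en_le1.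
Qed.

Lemma energy_lt c (e : R) : 0 < e -> \forall t \near U, en c t <= sup energies + e.
Proof.
move=> e0; apply: contrapT => /ultra_not H.
have : energies (sup energies + e).
  exists c; apply: filterS H => t /negP; rewrite -ltNge; exact: ltW.
move/(sup_upper_bound energies_has_sup); lra.
Qed.

Lemma energy_almost_maximal (e : R) : 0 < e ->
  exists c, \forall t \near U, sup energies - e <= en c t.
Proof.
move=> /sup_adherent/(_ energies_has_sup) [r [c Hc] lt_r]; exists c.
by apply: filterS Hc => t; apply: le_trans; exact: ltW.
Qed.

(** Cell averages whose energy tends to the supremum form a Cauchy sequence in
    [L^2]; a diagonal sequence is its limit. *)
Lemma condexp_exists : exists2 beta : ifun,
  in01 beta /\ (forall e, {subset P <= [pred g : {set J} | g \subset e]} -> dep e beta)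
  & meas P beta /\ orth P phi beta.
Proof.
pose eps m : R := m.+1%:R^-1.
have eps0 m : 0 < eps m by rewrite /eps invr_gt0.
have /choice [c Hc] m := energy_almost_maximal (eps0 m).
have refine m c' : (forall t (x y : V t), key P c' x = key P c' y ->
      key P (c m) x = key P (c m) y) ->
    \forall t \near U, avg (fun x => (sc c' t x - sc (c m) t x) ^+ 2) <= 2 * eps m.
  move=> c'c; apply: filterS2 (Hc m) (energy_lt c' (eps0 m)) => t.
  by rewrite energy_increment; [lra|exact: c'c].
(* Both averages are compared with the one for their common refinement, and the square of a sum is
   at most twice the sum of the squares. *)
have close p m : \forall t \near U,
    avg (fun x => (sc (c p) t x - sc (c m) t x) ^+ 2) <= 4 * eps p + 4 * eps m.
  pose cc (b : bool) := if b then c p else c m.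
  have h1 := refine p (join_coloring cc) (fun t x y => @key_join _ cc P true t x y).
  have h2 := refine m (join_coloring cc) (fun t x y => @key_join _ cc P false t x y).
  apply: filterS2 h1 h2 => t h1 h2.
  apply: (@le_trans _ _ (avg (fun x => 2 * (sc (join_coloring cc) t x - sc (c p) t x) ^+ 2
      + 2 * (sc (join_coloring cc) t x - sc (c m) t x) ^+ 2))); last first.
    by rewrite /avg wsumD !wsumZ -!/(avg _); lra.
  apply: avg_le => x.
  move: (sc (join_coloring cc) t x) (sc (c p) t x) (sc (c m) t x) => a b b'.
  rewrite -subr_ge0 [leRHS](_ : _ = (2 * a - b - b') ^+ 2) ?sqr_ge0//; ring.
have [mu Hmu] := near_diagonal Uoo close.
(* The coloring [c (mu t)] varies with [t], so [beta] need not be cellwise for any fixed coloring;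
   it is only an [L^1] limit of such functions. *)
pose beta : ifun := fun t x => sc (c (mu t)) t x.
have near_beta p : \forall t \near U,
    avg (fun x => (sc (c p) t x - beta t x) ^+ 2) <= 8 * eps p.
  apply: filterS (Hmu p) => t [le_p H]; apply: le_trans H _.
  have : eps (mu t) <= eps p by rewrite /eps lef_pV2 ?posrE ?ltr0n// ler_nat.
  lra.
have small_eps (e : R) : 0 < e -> exists p, eps p <= e.
  move=> e0; exists (Num.truncn e^-1).
  rewrite /eps -[leRHS]invrK lef_pV2 ?posrE ?invr_gt0// ?ltr0n//.
  exact/ltW/truncnS_gt.
have L1_of_L2 (f : ifun) (e K : R) (p : nat) : 0 < e -> eps p <= e ^+ 2 / K -> 0 < K ->
    (\forall t \near U, avg (fun x => f t x ^+ 2) <= K * eps p) ->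
    \forall t \near U, avg (fun x => `|f t x|) <= 2 * e.
  move=> e0 epsp K0; apply: filterS => t Hf.
  apply: le_trans (avg_norm_le_sqr _ (V_gt0 t) e0) _.
  rewrite (_ : 2 * e = e + e)%R; last by ring.
  rewrite lerD2l ler_pdivrMr//; apply: le_trans Hf _.
  by move: epsp; rewrite ler_pdivlMr// -expr2 mulrC.
exists beta; split.
- by move=> t x; exact: sc01.
- move=> e Pe t x y xy; apply: sc_cell; apply/key_eqP => g /Pe ge.
  apply: chi_dep => i ig; apply: xy; move: ge; rewrite inE => /fintype.subsetP.
  exact.
- move=> e e0.
  have e20 : 0 < (e / 2) ^+ 2 / 8 by rewrite divr_gt0 ?exprn_gt0//; lra.
  have [p Hp] := small_eps _ e20.
  exists (c p), (sc (c p)); split; [exact: sc_cell|exact: sc01|].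
  have e2 : 0 < e / 2 by lra.
  have := L1_of_L2 (fun t x => sc (c p) t x - beta t x) _ _ _ e2 Hp ltac:(lra) (near_beta p).
  apply: filterS => t; rewrite (_ : 2 * (e / 2) = e); last by field.
  by under eq_avg => x do rewrite distrC.
(* After refining by [c'], the cell average is exactly orthogonal to [s]; passing from it to
   [sc (c p)] and then to [beta] costs little in [L^1]. *)
move=> c' s cs s1; apply: small_approx => e e0; exists (fun=> 0); first exact: small0.
have e4 : 0 < e / 4 by lra.
have e20 : 0 < (e / 4) ^+ 2 / 8 by rewrite divr_gt0 ?exprn_gt0//; lra.
have [p Hp] := small_eps _ e20.
pose cc (b : bool) := if b then c p else c'.
have e20' : eps p <= (e / 4) ^+ 2 / 2.
  by apply: le_trans Hp _; have := sqr_ge0 (e / 4); lra.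
have h1 := L1_of_L2 (fun t x => sc (join_coloring cc) t x - sc (c p) t x) _ _ _ e4 e20'
   ltac:(lra) (refine p (join_coloring cc) (fun t x y => @key_join _ cc P true t x y)).
have h2 := L1_of_L2 (fun t x => sc (c p) t x - beta t x) _ _ _ e4 Hp ltac:(lra)
   (near_beta p).
apply: filterS2 h1 h2 => t h1 h2; rewrite normr0 add0r.
have -> : avg (fun x => (phi t x - beta t x) * s t x) =
    avg (fun x => (phi t x - sc (join_coloring cc) t x) * s t x) +
    avg (fun x => ((sc (join_coloring cc) t x - sc (c p) t x) + (sc (c p) t x - beta t x)) * s t x).
  by rewrite /avg -wsumD; apply: eq_wsum => x; ring.
rewrite avg_sub_cell_avg ?add0r; last first.
  by move=> x y /(@key_join _ cc P false)/cs.
apply: le_trans (ler_norm_avg _) _.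
apply: (@le_trans _ _ (avg (fun x => `|sc (join_coloring cc) t x - sc (c p) t x| +
   `|sc (c p) t x - beta t x|))); last first.
  by rewrite /avg wsumD -!/(avg _); lra.
apply: avg_le => x; rewrite normrM.
apply: le_trans (ler_piMr (normr_ge0 _) (s1 t x)) _; exact: ler_normD.
Qed.

End ConditionalExpectation.
End Internal.

(** * Relative independence *)

Section Mix.
Context {R : realType} {J T : finType} (e : {set J}).
Implicit Types (x y : {ffun J -> T}).

Definition mix x y : {ffun J -> T} := [ffun i => if i \in e then x i else y i].

Lemma mixK x y : mix (mix x y) (mix y x) = x.
Proof. by apply/ffunP => i; rewrite !ffunE; case: (i \in e). Qed.

(** Fubini for the splitting of the coordinates into [e] and its complement: exchanging the outer
    coordinates of two points is an involution on pairs, so it preserves the double sum. *)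
Lemma avg_mix (f : {ffun J -> T} -> R) :
  avg f = avg (fun y => avg (fun x => f (mix x y))).
Proof.
have [V0|V0] := eqVneq #|{ffun J -> T}| 0%N; first by rewrite !avgE V0 invr0 !mul0r.
rewrite !avgE; congr (_ * _).
under [RHS]eq_bigr => y _ do rewrite avgE.
rewrite -mulr_sumr pair_big /=.
pose h (p : {ffun J -> T} * {ffun J -> T}) := (mix p.1 p.2, mix p.2 p.1).
have hK : involutive h by case=> x y; rewrite /h /= !mixK.
rewrite (reindex_inj (inv_inj hK)) /=.
under [in RHS]eq_bigr => p _ do rewrite mixK.
rewrite -(pair_big xpredT xpredT (fun _ y => f y)) /= sumr_const.
rewrite [X in _ * X](_ : _ = #|{ffun J -> T}|%:R * \sum_j f j); last first.
  by rewrite mulr_natl; congr (_ *+ _); exact: eq_card.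
rewrite mulrA mulVf ?mul1r//.
by rewrite pnatr_eq0.
Qed.

End Mix.

Section Internal.
Context {R : realType} {J : finType} {X : nat -> finType}.
Context (U : set_system nat) {UF : UltraFilter U}.
Hypothesis Uoo : forall N, \forall t \near U, (N <= t)%N.

Local Notation V t := {ffun J -> X t}.
Local Notation ifun := (forall t, V t -> R).
Implicit Types (phi psi s : ifun) (P Q : pred {set J}) (e g : {set J}).
Implicit Types (c : @coloring J X).

Variable x0 : forall t, V t.

Lemma V_gt0 t : (0 < #|V t|)%N.
Proof. by apply/card_gt0P; exists (x0 t). Qed.

Definition low j : pred {set J} := [pred g : {set J} | (#|g| < j)%N].
Definition below e j : pred {set J} := [pred g : {set J} | (g \subset e) && (#|g| < j)%N].
(** Once the coordinates outside [e] are frozen, a function of the coordinates in such a [g] depends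
    on fewer than [j] coordinates, all in [e]. *)
Definition link e j : pred {set J} := [pred g : {set J} | (#|g :&: e| < j)%N].

Lemma below_low e j : {subset below e j <= low j}.
Proof. by move=> g /andP[]. Qed.

Lemma low_link e j : {subset low j <= link e j}.
Proof. by move=> g; rewrite !inE => /(leq_ltn_trans _); apply; exact/subset_leq_card/subsetIl. Qed.

Section Link.
Variables (e : {set J}) (j : nat) (phi beta F : ifun) (c : @coloring J X).
Arguments phi : clear implicits.
Arguments beta : clear implicits.
Arguments F : clear implicits.
Hypotheses (phie : dep e phi) (betae : dep e beta).
Hypothesis phi_beta : orth U (below e j) phi beta.
Hypotheses (Fc : cellwise (link e j) c F) (F1 : forall t x, `|F t x| <= 1).

(** All colours at sets with trace [g'] on [e] are gathered into one colour at [g']. *)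
Lemma section_dep (y : forall t, V t) (g' : {set J}) : dep g' (fun t (x : V t) =>
  [ffun g : {set J} => if g :&: e == g' then Some (chi c g (mix e x (y t))) else None]).
Proof.
move=> t x z xz; apply/ffunP => g; rewrite !ffunE; case: eqP => // gg'.
congr Some; apply: chi_dep => i ig; rewrite !ffunE; case: ifP => // ie.
by apply: xz; rewrite -gg' inE ig.
Qed.

(** For each [t], freeze the coordinates outside [e] at the worst point [y t]: then
    [F] is constant on the cells of a coloring of subsets of [e]. *)
Lemma orth_link : small (U := U) (fun t => avg (fun x => (phi t x - beta t x) * F t x)).
Proof.
pose A t (y : V t) := avg (fun x => (phi t x - beta t x) * F t (mix e x y)).
pose y t : V t := [arg max_(y > x0 t) `|A t y|]%O.
have yP t z : `|A t z| <= `|A t (y t)|.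
  rewrite /y; case: Order.TotalTheory.arg_maxP => // i _; exact.
have : small (U := U) (fun t => A t (y t)).
  apply: (phi_beta (c := Coloring (section_dep y)) (s := fun t x => F t (mix e x (y t)))).
    move=> t x z /key_eqP xz; apply: Fc; apply/key_eqP => g gl.
    have : below e j (g :&: e) by rewrite /below /= subsetIr.
    by move=> /xz /ffunP /(_ g); rewrite !ffunE eqxx => -[].
  by move=> t x; exact: F1.
move=> smallA d /smallA; apply: filterS => t; apply: le_trans.
rewrite (avg_mix e); apply: le_trans (ler_norm_avg _) _.
rewrite -[leRHS](avg_cst _ (V_gt0 t)); apply: avg_le => z.
rewrite (_ : avg _ = A t z) ?yP//; apply: eq_avg => x.
have mx : {in e, mix e x z =1 x} by move=> i ie; rewrite ffunE ie.
by rewrite (phie mx) (betae mx).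
Qed.

End Link.

Lemma in01_mul phi psi : in01 phi -> in01 psi -> in01 (fun t x => phi t x * psi t x).
Proof. by move=> h1 h2 t x; have := h1 t x; have := h2 t x; nra. Qed.

Lemma in01_prod (I : Type) (r : seq I) (A : pred I) (f : I -> ifun) :
  (forall i, in01 (f i)) -> in01 (fun t x => \prod_(i <- r | A i) f i t x).
Proof.
move=> f01 t x; elim/big_ind: _ => [|a b ha hb|i _]; [by rewrite ler01 lexx| |exact: f01].
by nra.
Qed.

Lemma in01_norm phi : in01 phi -> forall t x, `|phi t x| <= 1.
Proof. by move=> h t x; have /andP[h0 h1] := h t x; rewrite ger0_norm. Qed.

(** Applying [G] to approximants over a common refinement costs a factor [L]. This serves products
    and soft cut-offs alike. *)
Lemma meas_lip2 P phi psi (G : R -> R -> R) (L : R) : 0 < L ->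
  (forall a b a' b', 0 <= a <= 1 -> 0 <= b <= 1 -> 0 <= a' <= 1 -> 0 <= b' <= 1 ->
    `|G a b - G a' b'| <= L * (`|a - a'| + `|b - b'|)) ->
  (forall a b, 0 <= a <= 1 -> 0 <= b <= 1 -> 0 <= G a b <= 1) ->
  in01 phi -> in01 psi -> meas U P phi -> meas U P psi ->
  meas U P (fun t x => G (phi t x) (psi t x)).
Proof.
move=> L0 GL G01 phi01 psi01 mphi mpsi d d0.
have d20 : 0 < d / (2 * L) by apply: divr_gt0 => //; lra.
have [c1 [s1 [cs1 s101 near1]]] := mphi _ d20.
have [c2 [s2 [cs2 s201 near2]]] := mpsi _ d20.
pose cc (b : bool) := if b then c1 else c2.
exists (join_coloring cc), (fun t x => G (s1 t x) (s2 t x)); split.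
- move=> t x y xy; congr (G _ _).
    exact/cs1/(@key_join _ _ _ cc P true _ _ _ xy).
  exact/cs2/(@key_join _ _ _ cc P false _ _ _ xy).
- by move=> t x; exact: G01.
apply: filterS2 near1 near2 => t h1 h2.
apply: (@le_trans _ _ (avg (fun x => L * (`|phi t x - s1 t x| + `|psi t x - s2 t x|)))).
  by apply: avg_le => x; exact: GL.
rewrite /avg wsumZ wsumD -!/(avg _) mulrC -ler_pdivlMr//.
apply: le_trans (lerD h1 h2) _.
by rewrite le_eqVlt; apply/orP; left; apply/eqP; field; rewrite gt_eqF.
Qed.

Lemma meas_mul P phi psi : in01 phi -> in01 psi -> meas U P phi -> meas U P psi ->
  meas U P (fun t x => phi t x * psi t x).
Proof.
apply: (meas_lip2 (G := fun a b => a * b) (L := 1)) => //.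
  move=> a b a' b' /andP[a0 a1] hb ha' /andP[b'0 b'1]; rewrite mul1r.
  rewrite (_ : a * b - a' * b' = a * (b - b') + (a - a') * b'); last by ring.
  apply: le_trans (ler_normD _ _) _; rewrite addrC !normrM lerD//.
    by rewrite ler_piMr// ger0_norm.
  by rewrite ler_piMl// ger0_norm.
by move=> a b; nra.
Qed.

Lemma meas_cst01 P (a : R) : 0 <= a <= 1 -> meas U P (fun t (_ : V t) => a).
Proof.
by move=> a01; apply: (@cellwise_meas _ _ _ U _ P (trivial_coloring (X := X))).
Qed.

Lemma meas_prod P (I : Type) (r : seq I) (A : pred I) (f : I -> ifun) :
  (forall i, in01 (f i)) -> (forall i, A i -> meas U P (f i)) ->
  meas U P (fun t x => \prod_(i <- r | A i) f i t x).
Proof.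
move=> f01 fm; elim: r => [|i r IH].
  rewrite (_ : (fun _ _ => _) = (fun _ _ => 1)); last first.
    by apply: functional_extensionality_dep => t; apply/funext => x; rewrite big_nil.
  by apply: meas_cst01; rewrite ler01 lexx.
rewrite (_ : (fun _ _ => _) = (fun t x => (if A i then f i t x else 1) *
    \prod_(i <- r | A i) f i t x)); last first.
  apply: functional_extensionality_dep => t; apply/funext => x.
  by rewrite big_cons; case: ifP; rewrite ?mul1r.
apply: meas_mul; [|exact: in01_prod| |exact: IH].
  by case: (A i) => // t x; rewrite ler01 lexx.
case: (boolP (A i)) => [/fm//|_].
by apply: meas_cst01; rewrite ler01 lexx.
Qed.

(** [rep] is conditional expectation inside the coordinates [e], [cexp] the one on
    the whole space; [rep_cexp] compares them. *)
Definition cexp j psi gam := [/\ in01 psi, in01 gam, meas U (low j) gam &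
  forall s, in01 s -> meas U (low j) s ->
    small (U := U) (fun t => avg (fun x => (psi t x - gam t x) * s t x))].

Definition rep e j phi beta := [/\ in01 beta, dep e beta,
  meas U (below e j) beta & orth U (below e j) phi beta].

Lemma rep_exists e j phi : in01 phi -> exists beta, rep e j phi beta.
Proof.
move=> phi01; have [beta [b01 bdep] [bm bo]] :=
  condexp_exists Uoo V_gt0 (below e j) phi01.
by exists beta; split=> //; apply: bdep => g /andP[].
Qed.

(** Write [phi * psi - beta * gam] as [(phi - beta) * psi + beta * (psi - gam)]. The first term
    vanishes by [orth_link], once [s] is replaced by a cellwise [s']; the second because [beta * s]
    is again a test function for [psi]. *)
Lemma cexp_mul e j c phi beta psi gam : in01 phi -> dep e phi -> rep e j phi beta ->
  cellwise (link e j) c psi -> cexp j psi gam ->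
  cexp j (fun t x => phi t x * psi t x) (fun t x => beta t x * gam t x).
Proof.
move=> phi01 phie [b01 be bm bo] cpsi [psi01 g01 gm psigam].
have bl : meas U (low j) beta := meas_sub (@below_low e j) bm.
split; [exact: in01_mul|exact: in01_mul|exact: meas_mul|] => s s01 ms.
apply: small_approx => d d0; have [c' [s' [cs' s'01 near_s]]] := ms _ d0.
pose cc (b : bool) := if b then c else c'.
have small1 : small (U := U) (fun t => avg (fun x =>
    (phi t x - beta t x) * (psi t x * s' t x))).
  apply: (@orth_link e j _ _ _ (join_coloring cc)) => //.
    move=> t x y xy; rewrite (cpsi _ _ _ (@key_join _ _ _ cc _ true _ _ _ xy)).
    congr (_ * _); apply: cs'; apply: key_sub (@low_link e j) _.
    exact: (@key_join _ _ _ cc _ false _ _ _ xy).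
  exact/in01_norm/in01_mul.
have small2 := psigam _ (in01_mul b01 s01) (meas_mul b01 s01 bl ms).
exists (fun t => avg (fun x => (phi t x - beta t x) * (psi t x * s' t x)) +
    avg (fun x => (psi t x - gam t x) * (beta t x * s t x))); first exact: smallD.
apply: filterS near_s => t Hs.
rewrite [X in `|X| <= _](_ : _ = avg (fun x => (phi t x - beta t x) * (psi t x * s' t x)) +
    avg (fun x => (psi t x - gam t x) * (beta t x * s t x)) +
    avg (fun x => (phi t x - beta t x) * psi t x * (s t x - s' t x))); last first.
  by rewrite /avg -!wsumD; apply: eq_wsum => x; ring.
apply: le_trans (ler_normD _ _) _; rewrite lerD2l.
apply: le_trans (ler_norm_avg _) _; apply: le_trans Hs; apply: avg_le => x.
rewrite normrM ler_piMl// normrM.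
have := phi01 t x; have := b01 t x; have := in01_norm psi01 x.
move=> h1 h2 h3; apply: mulr_ile1 => //.
by rewrite ler_norml; lra.
Qed.

Lemma cexp1 j : cexp j (fun t (_ : V t) => 1) (fun t (_ : V t) => 1).
Proof.
have h01 : in01 (fun t (_ : V t) => 1 : R) by move=> t x; rewrite ler01 lexx.
split=> //; first by apply: meas_cst01; rewrite ler01 lexx.
move=> s _ _; apply: (@eq_small U UF R (fun=> 0)); last exact: small0.
move=> t.
rewrite /avg (@eq_wsum _ _ _ _ (fun=> 0 * 0)) => [|x]; first by rewrite wsumZ mul0r.
by rewrite subrr !mul0r.
Qed.

Lemma cellwise_prod P c (r : seq {set J}) (A : {set J} -> ifun) :
  (forall g, g \in r -> cellwise P c (A g)) ->
  cellwise P c (fun t x => \prod_(g <- r) A g t x).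
Proof.
move=> Ac t x y xy; rewrite big_seq [RHS]big_seq; apply: eq_bigr => g gr.
exact: Ac xy.
Qed.

(** An intersection with [j] elements would fill both sets and make them equal. *)
Lemma link_neq j g g' : (#|g| <= j)%N -> (#|g'| <= j)%N -> g' != g -> g' \in link g j.
Proof.
move=> gj g'j; apply: contraR; rewrite inE -leqNgt => jI.
have /eqP I' : g' :&: g == g' by rewrite eqEcard subsetIl (leq_trans g'j).
by rewrite eqEcard -{1}I' subsetIr (leq_trans gj)// -I'.
Qed.

Lemma link_nsub j e g : (#|g| <= j)%N -> ~~ (g \subset e) -> g \in link e j.
Proof.
move=> gj; apply: contraR; rewrite inE -leqNgt => jI.
have /eqP I' : g :&: e == g by rewrite eqEcard subsetIl (leq_trans gj).
by rewrite -I' subsetIr.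
Qed.

Section CellProducts.
Variables (j : nat) (c : @coloring J X) (A b : {set J} -> ifun).
Arguments A : clear implicits.
Arguments b : clear implicits.
Hypothesis A01 : forall g, in01 (A g).
Hypothesis Adep : forall g, dep g (A g).
Hypothesis Acell : forall g, cellwise (pred1 g) c (A g).
Hypothesis Arep : forall g, rep g j (A g) (b g).

(** The factors are split off one at a time by [cexp_mul]: the sets still to come have at most [j]
    elements and differ from [g], hence lie in [link g j]. *)
Lemma cexp_prod (r : seq {set J}) : uniq r -> {in r, forall g, (#|g| <= j)%N} ->
  cexp j (fun t x => \prod_(g <- r) A g t x) (fun t x => \prod_(g <- r) b g t x).
Proof.
elim: r => [_ _|g r IH /= /andP[gr ur] rj].
  rewrite (_ : (fun t x => _) = (fun _ _ => 1)); last first.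
    by apply: functional_extensionality_dep => t; apply/funext => x; rewrite big_nil.
  rewrite [X in cexp _ _ X](_ : _ = (fun _ _ => 1)); last first.
    by apply: functional_extensionality_dep => t; apply/funext => x; rewrite big_nil.
  exact: cexp1.
have gj : (#|g| <= j)%N by apply: rj; rewrite inE eqxx.
have rj' : {in r, forall g, (#|g| <= j)%N} by move=> h hr; apply: rj; rewrite inE hr orbT.
rewrite (_ : (fun t x => _) = (fun t x => A g t x * \prod_(g <- r) A g t x)); last first.
  by apply: functional_extensionality_dep => t; apply/funext => x; rewrite big_cons.
rewrite [X in cexp _ _ X](_ : _ = (fun t x => b g t x * \prod_(g <- r) b g t x)); last first.
  by apply: functional_extensionality_dep => t; apply/funext => x; rewrite big_cons.
apply: (@cexp_mul g j c) => //; last exact: IH.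
apply: cellwise_prod => h hr; apply: (cellwise_sub _ (@Acell h)) => _ /eqP->.
by apply: link_neq => //; [exact: rj'|apply: contraNneq gr => <-].
Qed.

(** Here [e] may have more than [j] elements. No factor belongs to a subset of [e]; in the
    application [phi] absorbs those. *)
Lemma cexp_mul_prod e phi beta (r : seq {set J}) : in01 phi -> dep e phi ->
  rep e j phi beta -> uniq r -> {in r, forall g, (#|g| <= j)%N && ~~ (g \subset e)} ->
  cexp j (fun t x => phi t x * \prod_(g <- r) A g t x)
         (fun t x => beta t x * \prod_(g <- r) b g t x).
Proof.
move=> phi01 phie phib ur rj; apply: (@cexp_mul e j c) => //.
  apply: cellwise_prod => g gr; apply: (cellwise_sub _ (@Acell g)) => _ /eqP->.
  by have /andP[] := rj g gr; exact: link_nsub.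
by apply: cexp_prod => // g /rj /andP[].
Qed.

End CellProducts.
End Internal.

(** * Soft cut-offs *)

Section Cut.
Context {R : realType}.
Implicit Types a b r L eta : R.

Definition clip r : R := if r <= 0 then 0 else if r <= 1 then r else 1.

Lemma clip01 r : 0 <= clip r <= 1.
Proof. by rewrite /clip; case: (lerP r 0) => ?; [|case: (lerP r 1) => ?]; lra. Qed.

Lemma clip_lip r r' : `|clip r - clip r'| <= `|r - r'|.
Proof.
wlog le_r : r r' / r' <= r.
  move=> H; case/orP: (le_total r' r) => /H//.
  by rewrite (distrC (clip r)) (distrC r).
rewrite [leRHS]ger0_norm ?subr_ge0// ler_norml /clip.
case: (lerP r 0) => ?; [|case: (lerP r 1) => ?];
 case: (lerP r' 0) => ?; try lra; case: (lerP r' 1) => ?; lra.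
Qed.

(** A continuous stand-in for the indicator of [a <= eta * b], so that it inherits
    measurability from [a] and [b]. *)
Definition soft_cut L eta a b := clip (L * (eta * b - a)).

Lemma cut01 L eta a b : 0 <= soft_cut L eta a b <= 1.
Proof. exact: clip01. Qed.

Lemma cut_lip L eta a b a' b' : 0 < L -> 0 < eta <= 1 ->
  `|soft_cut L eta a b - soft_cut L eta a' b'| <= L * (`|a - a'| + `|b - b'|).
Proof.
move=> L0 /andP[eta0 eta1]; apply: le_trans (clip_lip _ _) _.
rewrite -mulrBr normrM gtr0_norm// ler_pM2l//.
rewrite (_ : _ - _ = eta * (b - b') - (a - a')); last by ring.
apply: le_trans (ler_normB _ _) _; rewrite addrC lerD2l normrM gtr0_norm//.
by rewrite ler_piMl.
Qed.

Lemma cut_gt0 L eta a b : 0 < L -> 0 < soft_cut L eta a b -> a <= eta * b.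
Proof.
move=> L0; rewrite /soft_cut /clip; case: (lerP (L * _) 0) => [_|+ _]; first by rewrite ltxx.
by rewrite pmulr_rgt0// subr_gt0 => /ltW.
Qed.

(** Read backwards, a positive cut-off bounds the conditional probability [b] from below. *)
Lemma cut_le L b : 0 < L -> 0 <= b -> soft_cut L 1 0 b <= L * b.
Proof.
move=> L0 b0; have : 0 <= L * b by rewrite mulr_ge0// ltW.
by rewrite /soft_cut /clip mul1r subr0; case: (lerP (L * b) 0) => ?; [|case: (lerP (L * b) 1) => ?]; lra.
Qed.

(** A pointwise Markov inequality: either the cut-off is 1, or [eta * b - a] is below [L^-1]. *)
Lemma cut_defect L eta a b : 0 < L -> 0 < eta -> 0 <= a -> 0 <= b ->
  b * (1 - soft_cut L eta a b) <= (a + L^-1) / eta.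
Proof.
move=> L0 eta0 a0 b0; have Li : 0 < L^-1 by rewrite invr_gt0.
have rhs0 : 0 <= (a + L^-1) / eta by apply: divr_ge0; lra.
have [h|h] := lerP 1 (L * (eta * b - a)).
  rewrite /soft_cut /clip; case: (lerP (L * _) 0) => [?|_]; first lra.
  by case: (lerP (L * _) 1) => [?|_]; [rewrite (_ : L * _ = 1)|]; lra.
apply: (@le_trans _ _ b).
  by rewrite ler_piMr//; have := cut01 L eta a b; lra.
rewrite ler_pdivlMr// mulrC.
have : eta * b - a <= L^-1 by rewrite -(ler_pM2l L0) mulfV ?gt_eqF// ltW.
lra.
Qed.

Lemma one_sub_prod (I : Type) (r : seq I) (P : pred I) (u : I -> R) :
  (forall i, 0 <= u i <= 1) ->
  1 - \prod_(i <- r | P i) u i <= \sum_(i <- r | P i) (1 - u i).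
Proof.
move=> u01; have : 0 <= \prod_(i <- r | P i) u i <= 1 /\
  1 - \prod_(i <- r | P i) u i <= \sum_(i <- r | P i) (1 - u i).
  elim: r => [|i r IH]; first by rewrite !big_nil; lra.
  rewrite !big_cons; case: (P i) => //; have := u01 i; move: IH.
  move: (\prod_(_ <- r | _) _) (u i) => p q [hp hs] hq.
  by split; [nra|]; move: hs; move: (\sum_(_ <- r | _) _) => S hs; nra.
by case.
Qed.

End Cut.

(** * The Markov bound for cut-offs of conditional expectations *)

Section Internal.
Context {R : realType} {J : finType} {X : nat -> finType}.
Context (U : set_system nat) {UF : UltraFilter U}.
Hypothesis Uoo : forall N, \forall t \near U, (N <= t)%N.

Local Notation V t := {ffun J -> X t}.
Local Notation ifun := (forall t, V t -> R).
Local Notation small := (small (U := U)).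
Implicit Types (phi psi s : ifun) (P Q : pred {set J}) (e g : {set J}).
Implicit Types (c : @coloring J X).

Variable x0 : forall t, V t.

Lemma smallZ (k : R) (u : nat -> R) : small u -> small (fun t => k * u t).
Proof.
move=> su d d0; have k0 : 0 < `|k| + 1 by have := normr_ge0 k; lra.
have := su (d / (`|k| + 1)) (divr_gt0 d0 k0).
apply: filterS => t; rewrite ler_pdivlMr// normrM => h.
by apply: le_trans h; rewrite mulrC ler_wpM2l//; lra.
Qed.

Lemma rep_cexp e j phi beta : in01 phi -> dep e phi -> rep U e j phi beta ->
  cexp U j phi beta.
Proof.
move=> phi01 phie r; have := cexp_mul (UF := UF) x0 phi01 phie r (c := trivial_coloring (X := X))
  (psi := fun t _ => 1) (gam := fun t _ => 1).
case=> //; first exact: cexp1.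
move=> _ ? ? H.
case: r => b01 be bm bo; split=> //.
  exact: meas_sub (@below_low _ e j) bm.
move=> s s01 sm; apply: eq_small (H s s01 sm) => t.
by apply: eq_avg => x; rewrite !mulr1.
Qed.

Lemma rep0 e j phi : (forall t x, phi t x = 0) -> rep U e j phi (fun t (_ : V t) => 0).
Proof.
move=> phi0; split=> //.
- by move=> t x; rewrite lexx ler01.
- by apply: meas_cst01; rewrite lexx ler01.
move=> c s _ _; apply: (@eq_small U UF R (fun=> 0)); last exact: small0.
move=> t; rewrite /avg (@eq_wsum _ _ _ _ (fun=> 0 * 0)) => [|x].
  by rewrite wsumZ mul0r.
by rewrite phi0 subrr !mul0r.
Qed.

Lemma meas_cut P (L eta : R) phi psi : 0 < L -> 0 < eta <= 1 -> in01 phi -> in01 psi ->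
  meas U P phi -> meas U P psi ->
  meas U P (fun t x => soft_cut L eta (phi t x) (psi t x)).
Proof.
move=> L0 eta01; apply: (meas_lip2 (G := soft_cut L eta) (L := L)) => //.
  by move=> *; exact: cut_lip.
by move=> *; exact: cut01.
Qed.

(** Since [1 - soft_cut] is measurable at the lower level, [A k] may be traded for [b k] at
    vanishing cost; then [cut_defect] applies. The averages of the [a k] add up to that of [z] in
    the limit, because the [A k] sum to 1. *)
Lemma cut_exceptional e j (K : finType) (z : ifun) (A a b : K -> ifun) (L eta : R) :
  0 < L -> 0 < eta <= 1 -> in01 z -> dep e z ->
  (forall k, in01 (A k)) -> (forall k, dep e (A k)) ->
  (forall t x, \sum_k A k t x = 1) ->
  (forall k, rep U e j (fun t x => z t x * A k t x) (a k)) ->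
  (forall k, rep U e j (A k) (b k)) ->
  exists2 v, small v & forall t,
    avg (fun x => \sum_k A k t x * (1 - soft_cut L eta (a k t x) (b k t x))) <=
    (avg (z t) + #|K|%:R / L) / eta + v t.
Proof.
move=> L0 eta01 z01 ze A01 Ae A1 ra rb; have /andP[eta0 _] := eta01.
pose S k : ifun := fun t x => 1 - soft_cut L eta (a k t x) (b k t x).
have S01 k : in01 (S k).
  by move=> t x; rewrite /S; have := cut01 L eta (a k t x) (b k t x); lra.
have Sm k : meas U (low j) (S k).
  case: (ra k) => a01 _ am _; case: (rb k) => b01 _ bm _.
  apply: (meas_lip2 (G := fun a b => 1 - soft_cut L eta a b) (L := L)) => //.
  - move=> a1 b1 a2 b2 _ _ _ _.
    rewrite (_ : _ - _ = - (soft_cut L eta a1 b1 - soft_cut L eta a2 b2)); last by ring.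
    by rewrite normrN; exact: cut_lip.
  - by move=> a1 b1 _ _; have := cut01 L eta a1 b1; lra.
  - exact: meas_sub (@below_low _ e j) am.
  - exact: meas_sub (@below_low _ e j) bm.
pose D1 k t := avg (fun x => (A k t x - b k t x) * S k t x).
pose D2 k t := avg (fun x => (z t x * A k t x - a k t x) * 1).
have sD1 k : small (D1 k).
  by have [_ _ _] := rep_cexp (A01 k) (Ae k) (rb k); apply.
have sD2 k : small (D2 k).
  have zA01 : in01 (fun t x => z t x * A k t x) by exact: in01_mul.
  have zAe : dep e (fun t x => z t x * A k t x).
    by move=> t x y xy; rewrite (ze _ _ _ xy) (Ae k _ _ _ xy).
  have [_ _ _] := rep_cexp zA01 zAe (ra k); apply.
    by move=> t x; rewrite ler01 lexx.
  by apply: meas_cst01; rewrite ler01 lexx.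
exists (fun t => \sum_k (D1 k t + (- eta^-1) * D2 k t)).
  by apply: small_sum => k; apply: smallD => //; exact: smallZ.
move=> t; rewrite {1}/avg wsum_sum -/(avg _).
have -> : (avg (z t) + #|K|%:R / L) / eta =
    \sum_k (avg (fun x => z t x * A k t x) + L^-1) / eta.
  rewrite -mulr_suml big_split /= sumr_const -[L^-1 *+ _]mulr_natl; congr ((_ + _) / _).
  rewrite /avg -wsum_sum; apply: eq_wsum => x.
  by rewrite -mulr_sumr A1 mulr1.
rewrite -big_split /=; apply: ler_sum => k _.
rewrite -/(avg _).
have -> : avg (fun x => A k t x * (1 - soft_cut L eta (a k t x) (b k t x))) =
    avg (fun x => b k t x * S k t x) + D1 k t.
  by rewrite /D1 /avg -wsumD; apply: eq_wsum => x; rewrite /S; ring.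
have -> : D2 k t = avg (fun x => z t x * A k t x) - avg (a k t).
  by rewrite /D2 /avg -wsumB; apply: eq_wsum => x; ring.
have : avg (fun x => b k t x * S k t x) <= (avg (a k t) + L^-1) / eta.
  rewrite [leRHS]mulrC -(avg_cst L^-1 (V_gt0 x0 t)) /avg -wsumD -wsumZ -!/(avg _).
  apply: avg_le => x; rewrite [leRHS]mulrC; apply: cut_defect => //.
    by case: (ra k) => /(_ t x) /andP[].
  by case: (rb k) => /(_ t x) /andP[].
move: (avg _) (avg _) (avg _) (D1 k t) => p1 p2 p3 p4.
rewrite !mulrDl; lra.
Qed.

End Internal.

(** * Simplex counting *)

Section Bounds.
Context {R : realType}.

(** If some [u i] is further than [tau / 2] from [v i], the left side is at most 0; otherwise every
    [u i] is at least [tau / 2]. *)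
Lemma prod_lower (I : finType) (P : pred I) (u v : I -> R) (tau : R) : 0 < tau ->
  (forall i, P i -> 0 <= u i) -> (forall i, P i -> tau <= v i) ->
  (\prod_(i | P i) (tau / 2)) * (1 - \sum_(i | P i) (2 / tau) * `|u i - v i|) <=
  \prod_(i | P i) u i.
Proof.
move=> tau0 u0 tv; have tau2 : 0 < tau / 2 by lra.
have p0 : 0 <= \prod_(i | P i) (tau / 2) by apply: prodr_ge0 => i _; exact: ltW.
have S0 i : 0 <= (2 / tau) * `|u i - v i|.
  by apply: mulr_ge0 => //; apply: divr_ge0; lra.
have [/existsP[i /andP[Pi Hi]]|nex] := boolP [exists i, P i && (tau / 2 < `|u i - v i|)].
  apply: (@le_trans _ _ 0); last by apply: prodr_ge0 => k /u0.
  apply: mulr_ge0_le0 => //; rewrite subr_le0 (bigD1 i)//=.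
  apply: (@le_trans _ _ ((2 / tau) * `|u i - v i|)); last first.
    by rewrite lerDl; apply: sumr_ge0.
  by rewrite mulrAC ler_pdivlMr// mul1r; lra.
apply: (@le_trans _ _ (\prod_(i | P i) (tau / 2))).
  by rewrite ler_piMr// gerBl; apply: sumr_ge0.
apply: ler_prod => i Pi; rewrite (ltW tau2) /=.
move: nex; rewrite negb_exists => /forallP /(_ i); rewrite Pi /= -leNgt.
by have := tv i Pi; rewrite ler_norml; lra.
Qed.

Lemma sum_le_card (I : finType) (P : pred I) (F : I -> R) (B : R) : 0 <= B ->
  (forall i, P i -> F i <= B) -> \sum_(i | P i) F i <= #|I|%:R * B.
Proof.
move=> B0 FB; apply: (@le_trans _ _ (\sum_(i : I) B)).
  rewrite big_mkcond; apply: ler_sum => i _.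
  by case: ifP => // /FB.
by rewrite sumr_const mulr_natl.
Qed.

End Bounds.

Section Counting.
Context {R : realType} {J : finType} {X : nat -> finType}.
Context (U : set_system nat) {UF : UltraFilter U}.
Hypothesis Uoo : forall N, \forall t \near U, (N <= t)%N.

Local Notation V t := {ffun J -> X t}.
Local Notation ifun := (forall t, V t -> R).
Local Notation small := (small (U := U)).
Implicit Types (phi psi s : ifun) (P Q : pred {set J}) (e g : {set J}).
Implicit Types (c : @coloring J X).

Variable x0 : forall t, V t.
Variable w : forall t, V t -> R.
Arguments w : clear implicits.
Hypothesis w_ge0 : forall t x, 0 <= w t x.
Hypothesis w_dom : forall e, e != [set: J]%SET -> forall phi,
  (forall t x, 0 <= phi t x) -> dep e phi -> forall t, wsum (w t) (phi t) <= avg (phi t).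

Lemma cellwise_dep P e c s : {subset P <= [pred g : {set J} | g \subset e]} ->
  cellwise P c s -> dep e s.
Proof.
move=> Pe cs t x y xy; apply: cs; apply/key_eqP => g /Pe; rewrite inE => /fintype.subsetP ge.
by apply: chi_dep => i /ge /xy.
Qed.

Definition pos (u : nat -> R) := exists2 a, 0 < a & \forall t \near U, a <= u t.

Definition counts j := forall W : {set J} -> ifun,
  (forall e, in01 (W e)) -> (forall e, dep e (W e)) ->
  (forall e, meas U (below e j) (W e)) ->
  pos (fun t => wsum (w t) (fun x => \prod_(e | e != [set: J]%SET) W e t x)) ->
  pos (fun t => avg (fun x => \prod_(e | e != [set: J]%SET) W e t x)).

Lemma card_sets_gt0 : 0 < #|{set J}|%:R :> R.
Proof. by rewrite ltr0n; apply/card_gt0P; exists finset.set0. Qed.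

(** No set has fewer than 0 elements, so each [W e] is close in [L^1] to a constant for each [t].
    Domination bounds its average below by [a], hence the constant by [a / 2]. *)
Lemma counts0 : counts 0.
Proof.
move=> W W01 Wdep Wm [a a0 Ha]; have Q0 := card_sets_gt0.
(* The first bound on [d] keeps the constants above [a / 2]; the second limits the loss in
   [prod_lower] to one half. *)
set Q : R := #|{set J}|%:R in Q0; pose d := Num.min (a / 2) (a / (8 * Q)).
have d0 : 0 < d by rewrite lt_min !divr_gt0//; lra.
have [da dQ] : d <= a / 2 /\ Q * d <= a / 8.
  split; first by rewrite ge_min lexx.
  have : d <= a / (8 * Q) by rewrite ge_min lexx orbT.
  rewrite -(ler_pM2l Q0); move/le_trans; apply.
  by rewrite le_eqVlt; apply/orP; left; apply/eqP; field; rewrite gt_eqF.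
have near_e e : e != [set: J]%SET -> exists s, (forall t x y, s t x = s t y) /\
    \forall t \near U, (forall x, a / 2 <= s t x) /\ avg (fun x => `|W e t x - s t x|) <= d.
  move=> eT; have [c [s [cs s01 near_s]]] := Wm e d d0.
  have scst t x y : s t x = s t y by apply: cs; apply/key_eqP => g /andP[].
  exists s; split=> //; apply: filterS2 Ha near_s => t Hat Hst; split=> // x.
  have : a <= avg (W e t).
    apply: le_trans Hat _; apply: le_trans (w_dom eT _ (Wdep e) t); last first.
      by move=> u y; case/andP: (W01 e u y).
    apply: wsum_le => // y; rewrite (bigD1 e)//= ler_piMr//.
      by case/andP: (W01 e t y).
    by have /(_ t y) /andP[] := in01_prod (index_enum _) (fun i => (i != [set: J]%SET) && (i != e)) W01.
  have -> : avg (W e t) = avg (fun y => W e t y - s t y) + s t x.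
    rewrite -[X in _ + X](avg_cst _ (V_gt0 x0 t)) /avg -wsumD.
    by apply: eq_wsum => y; rewrite (scst t x y) subrK.
  have := ler_norm_avg (fun y => W e t y - s t y); rewrite ler_norml; lra.
have /choice [s Hs] e : exists s, e != [set: J]%SET ->
    (forall t x y, s t x = s t y) /\
    \forall t \near U, (forall x, a / 2 <= s t x) /\ avg (fun x => `|W e t x - s t x|) <= d.
  by have [/near_e [s ?]|_] := boolP (e != [set: J]%SET); [exists s|exists (W e)].
have near_all : \forall t \near U, forall e, e != [set: J]%SET ->
    (forall x, a / 2 <= s e t x) /\ avg (fun x => `|W e t x - s e t x|) <= d.
  apply: near_forall_fin => e; have [eT|_] := boolP (e != [set: J]%SET); last exact: filterE.
  by have [_] := Hs e eT; apply: filterS.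
pose k := \prod_(e | e != [set: J]%SET) (a / 2 / 2).
have k0 : 0 < k by apply: prodr_gt0 => e _; lra.
exists (k / 2); first by lra.
apply: filterS near_all => t Ht.
apply: (@le_trans _ _ (avg (fun x => k * (1 +
    (- (2 / (a / 2))) * \sum_(e | e != [set: J]%SET) `|W e t x - s e t x|)))); last first.
  apply: avg_le => x; rewrite mulNr mulr_sumr; apply: prod_lower; first lra.
    by move=> e _; case/andP: (W01 e t x).
  by move=> e /Ht [].
rewrite /avg wsumZ wsumD wsumZ wsum_sum -/(avg _) avg_cst ?V_gt0//.
rewrite ler_pM2l//.
have : \sum_(e | e != [set: J]%SET) avg (fun x => `|W e t x - s e t x|) <= Q * d.
  by apply: sum_le_card => [|e /Ht []//]; exact: ltW.
rewrite -!/(avg _); move: (\sum_(e | _) _) => S HS.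
have : 2 / (a / 2) * S <= 2 / (a / 2) * (a / 8).
  by rewrite ler_pM2l ?divr_gt0//; lra.
have -> : 2 / (a / 2) * (a / 8) = 1 / 2 by field; rewrite gt_eqF.
by rewrite mulNr; lra.
Qed.

End Counting.

(** * Cells, boxes and their cut-offs *)

Section Step.
Context {R : realType} {J : finType} {X : nat -> finType}.
Context (U : set_system nat) {UF : UltraFilter U}.
Hypothesis Uoo : forall N, \forall t \near U, (N <= t)%N.

Local Notation V t := {ffun J -> X t}.
Local Notation ifun := (forall t, V t -> R).
Local Notation small := (small (U := U)).
Local Notation proper := (fun e : {set J} => e != [set: J]%SET).
Implicit Types (phi psi s : ifun) (P Q : pred {set J}) (e g : {set J}).

Variable x0 : forall t, V t.

Variables (j : nat) (c : @coloring J X).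

Local Notation K := {ffun {set J} -> option (color c)}.
Implicit Types (k : K).

Definition cell e k : ifun := fun t x => (key (below e j.+1) c x == k)%:R.
Definition hue g (o : option (color c)) : ifun := fun t x => (Some (chi c g x) == o)%:R.
Definition restr e k : K := [ffun g => if below e j.+1 g then k g else None].
Arguments cell : clear implicits.
Arguments hue : clear implicits.

Lemma in01_bool (b : forall t, V t -> bool) : in01 (fun t x => (b t x)%:R : R).
Proof. by move=> t x; case: (b t x); rewrite ?lexx ler01. Qed.

Lemma cell01 e k : in01 (cell e k).
Proof. exact: in01_bool. Qed.

Lemma hue01 g o : in01 (hue g o).
Proof. exact: in01_bool. Qed.

Lemma cell_dep e k : dep e (cell e k).
Proof.
have cc : cellwise (below e j.+1) c (cell e k) by move=> t x y xy; rewrite /cell xy.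
by apply: (@cellwise_dep _ _ _ (below e j.+1)) cc => g /andP[].
Qed.

Lemma hue_cell g o : cellwise (pred1 g) c (hue g o).
Proof. by move=> t x y /key_eqP xy; rewrite /hue xy//= eqxx. Qed.

Lemma hue_dep g o : dep g (hue g o).
Proof. by move=> t x y xy; rewrite /hue (@chi_dep _ _ c g t x y xy). Qed.

Definition levels := enum (low j.+1 : pred {set J}).

Lemma mem_levels g : (g \in levels) = (#|g| < j.+1)%N.
Proof. by rewrite mem_enum. Qed.

Definition box k : ifun := fun t x => \prod_(g <- levels) hue g (k g) t x.
Arguments box : clear implicits.

(** The hues at subsets of [e] combine into one cell. The sets that remain are not contained in [e],
    as [cexp_mul_prod] demands. *)
Lemma box_split e k t (x : V t) : box k t x =
  cell e (restr e k) t x * \prod_(g <- [seq g : {set J} <- levels | ~~ (g \subset e)]) hue g (k g) t x.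
Proof.
rewrite /box /cell !prod_bool -natrM mulnb; congr (nat_of_bool _)%:R.
apply/allP/andP => [H|[/eqP/ffunP H1 /allP H2] g gl].
  split; last by apply/allP => g; rewrite mem_filter => /andP[_]; exact: H.
  apply/eqP/ffunP => g; rewrite !ffunE; case: ifP => // /andP[_ gj].
  by apply/eqP/H; rewrite mem_levels.
have [ge|ge] := boolP (g \subset e); last by apply: H2; rewrite mem_filter ge.
by have := H1 g; rewrite !ffunE /below /= ge -mem_levels gl /= => ->.
Qed.

Lemma key_restr e t (x : V t) : key (below e j.+1) c x = restr e (key (low j.+1) c x).
Proof.
apply/ffunP => g; rewrite !ffunE; case: ifP => // /andP[_ gj].
by rewrite /low /= gj.
Qed.

Lemma key_box k t (x : V t) : box k t x != 0 ->
  forall g, (#|g| < j.+1)%N -> Some (chi c g x) = k g.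
Proof.
rewrite /box prod_bool; case: allP => [H _ g gj|_]; last by rewrite eqxx.
by apply/eqP/H; rewrite mem_levels.
Qed.

(** [aa e k], [bb e k] and [b g o] are the conditional expectations of
    [z e * cell e k], [cell e k] and [hue g o] on lower order sets; [z e] will be
    the error in approximating a function by one constant on cells. *)
Section Weights.
Variables (z : {set J} -> ifun) (aa bb : {set J} -> K -> ifun).
Variable b : {set J} -> option (color c) -> ifun.
Arguments z : clear implicits.
Arguments aa : clear implicits.
Arguments bb : clear implicits.
Arguments b : clear implicits.
Hypotheses (z01 : forall e, in01 (z e)) (zdep : forall e, dep e (z e)).
Hypothesis aa_rep : forall e k, rep U e j (fun t x => z e t x * cell e k t x) (aa e k).
Hypothesis bb_rep : forall e k, rep U e j (cell e k) (bb e k).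
Hypothesis b_rep : forall g o, rep U g j (hue g o) (b g o).
Variables (L eta : R).
Hypotheses (L0 : 0 < L) (eta01 : 0 < eta <= 1).

Definition cell_cutoff e k : ifun := fun t x => soft_cut L eta (aa e k t x) (bb e k t x).
Definition hue_cutoff g o : ifun := fun t x => soft_cut L 1 0 (b g o t x).
Arguments cell_cutoff : clear implicits.
Arguments hue_cutoff : clear implicits.

(** Both conditions are measurable in [below e j], one level down, which opens the way to the
    induction hypothesis. The hue condition concerns only the sets in [levels]. *)
Definition cutoff k e : ifun := fun t x =>
  cell_cutoff e (restr e k) t x * (if (#|e| < j.+1)%N then hue_cutoff e (k e) t x else 1).
Arguments cutoff : clear implicits.

Lemma cell_cutoff01 e k : in01 (cell_cutoff e k). Proof. by move=> t x; exact: cut01. Qed.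
Lemma hue_cutoff01 g o : in01 (hue_cutoff g o). Proof. by move=> t x; exact: cut01. Qed.

Lemma cell_cutoff_meas e k : meas U (below e j) (cell_cutoff e k).
Proof.
by have [? _ ? _] := aa_rep e k; have [? _ ? _] := bb_rep e k; exact: meas_cut.
Qed.

Lemma hue_cutoff_meas g o : meas U (below g j) (hue_cutoff g o).
Proof.
have [? _ ? _] := b_rep g o; apply: (meas_cut (phi := fun t _ => 0)) => //.
- by rewrite ltr01 lexx.
- by move=> t x; rewrite lexx ler01.
- by apply: meas_cst01; rewrite lexx ler01.
Qed.

Lemma cutoff01 k e : in01 (cutoff k e).
Proof.
apply: in01_mul; first exact: cell_cutoff01.
by case: (_ < _)%N; [exact: hue_cutoff01|move=> t x; rewrite ler01 lexx].
Qed.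

Lemma cutoff_dep k e : dep e (cutoff k e).
Proof.
move=> t x y xy; rewrite /cutoff /cell_cutoff /hue_cutoff.
have [_ ae _ _] := aa_rep e (restr e k); have [_ be _ _] := bb_rep e (restr e k).
have [_ be' _ _] := b_rep e (k e).
by rewrite (ae _ _ _ xy) (be _ _ _ xy) (be' _ _ _ xy).
Qed.

Lemma cutoff_meas k e : meas U (below e j) (cutoff k e).
Proof.
have one01 : in01 (fun t (_ : V t) => 1 : R) by move=> t x; rewrite ler01 lexx.
have one_meas : meas U (below e j) (fun t (_ : V t) => 1 : R).
  by apply: meas_cst01; rewrite ler01 lexx.
apply: meas_mul; [exact: cell_cutoff01| |exact: cell_cutoff_meas|].
  by case: (_ < _)%N; [exact: hue_cutoff01|].
by case: (_ < _)%N; [exact: hue_cutoff_meas|].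
Qed.

(** The hue cut-offs are left out: [cutoff_le_box] spends them on producing the box. *)
Definition cutoff_prod k : ifun := fun t x => \prod_(e | proper e) cell_cutoff e (restr e k) t x.
Arguments cutoff_prod : clear implicits.

Lemma cutoff_prod01 k : in01 (cutoff_prod k).
Proof. by apply: in01_prod => e; exact: cell_cutoff01. Qed.

Lemma cutoff_prod_meas k : meas U (low j) (cutoff_prod k).
Proof.
apply: meas_prod => [e|e _]; first exact: cell_cutoff01.
exact: meas_sub (@below_low _ e j) (cell_cutoff_meas e _).
Qed.

Lemma cutoff_prod_aa k e t x : proper e ->
  cutoff_prod k t x * aa e (restr e k) t x <= eta * (cutoff_prod k t x * bb e (restr e k) t x).
Proof.
move=> eT; rewrite /cutoff_prod (bigD1 e)//= -!mulrA [eta * _]mulrCA.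
set M := \prod_(_ | _) _.
have M0 : 0 <= M.
  by have /(_ t x) /andP[] := in01_prod (index_enum _) (fun i => proper i && (i != e))
    (fun i => cell_cutoff01 i (restr i k)).
have := @cell_cutoff01 e (restr e k) t x; rewrite le_eqVlt => /andP[/orP[/eqP<-|cell_cutoff0] _].
  by rewrite !mul0r.
rewrite ler_pM2l// mulrCA ler_wpM2l//; exact: cut_gt0 cell_cutoff0.
Qed.

Lemma cexp_box (k : K) :
  cexp U j (box k) (fun t x => \prod_(g <- levels) b g (k g) t x).
Proof.
apply: (cexp_prod (A := fun g => hue g (k g)) (b := fun g => b g (k g)) x0 (c := c)) => //.
- by move=> g; exact: hue01.
- by move=> g; exact: hue_dep.
- by move=> g; exact: hue_cell.
- exact: enum_uniq.
by move=> g; rewrite mem_levels.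
Qed.

Lemma box_mul_rep (k : K) e phi beta : in01 phi -> dep e phi -> rep U e j phi beta ->
  cexp U j (fun t x => phi t x *
      \prod_(g <- [seq g : {set J} <- levels | ~~ (g \subset e)]) hue g (k g) t x)
    (fun t x => beta t x *
      \prod_(g <- [seq g : {set J} <- levels | ~~ (g \subset e)]) b g (k g) t x).
Proof.
move=> phi01 phie r.
apply: (cexp_mul_prod (A := fun g => hue g (k g)) (b := fun g => b g (k g)) x0 (c := c) _ _ _ _ phi01 phie r) => //.
- by move=> g; exact: hue01.
- by move=> g; exact: hue_dep.
- by move=> g; exact: hue_cell.
- exact/filter_uniq/enum_uniq.
by move=> g; rewrite mem_filter mem_levels => /andP[-> gj]; rewrite andbT -ltnS.
Qed.

(** Both averages are replaced by those of conditional expectations, [aa * B] and [bb * B] with the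
    same [B]; these compare pointwise by [cutoff_prod_aa]. *)
Lemma box_defect k e : proper e -> exists2 v, small v & forall t,
  avg (fun x => z e t x * (box k t x * cutoff_prod k t x)) <=
  eta * avg (fun x => box k t x * cutoff_prod k t x) + v t.
Proof.
move=> eT; have /andP[eta0 _] := eta01.
have zc01 : in01 (fun t x => z e t x * cell e (restr e k) t x).
  by apply: in01_mul => //; exact: cell01.
have zcdep : dep e (fun t x => z e t x * cell e (restr e k) t x).
  by move=> t x y xy; rewrite (zdep xy) (cell_dep _ xy).
have [_ _ _ /(_ _ (cutoff_prod01 k) (cutoff_prod_meas k)) sa] :=
  box_mul_rep k zc01 zcdep (aa_rep e (restr e k)).
have [_ _ _ /(_ _ (cutoff_prod01 k) (cutoff_prod_meas k)) sb] :=
  box_mul_rep k (@cell01 e _) (@cell_dep e _) (bb_rep e (restr e k)).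
have small_v := smallD sa (smallZ (- eta) sb).
eexists; first exact: small_v.
move=> t /=.
pose B (x : V t) := \prod_(g <- [seq g : {set J} <- levels | ~~ (g \subset e)]) b g (k g) t x.
pose H (x : V t) := \prod_(g <- [seq g : {set J} <- levels | ~~ (g \subset e)]) hue g (k g) t x.
have -> : avg (fun x => z e t x * (box k t x * cutoff_prod k t x)) =
   avg (fun x => (z e t x * cell e (restr e k) t x * H x -
      aa e (restr e k) t x * B x) * cutoff_prod k t x) +
   avg (fun x => aa e (restr e k) t x * B x * cutoff_prod k t x).
  by rewrite /avg -wsumD; apply: eq_wsum => x; rewrite (box_split e) -/(H x); ring.
have -> : avg (fun x => box k t x * cutoff_prod k t x) =
   avg (fun x => (cell e (restr e k) t x * H x -
      bb e (restr e k) t x * B x) * cutoff_prod k t x) +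
   avg (fun x => bb e (restr e k) t x * B x * cutoff_prod k t x).
  by rewrite /avg -wsumD; apply: eq_wsum => x; rewrite (box_split e) -/(H x); ring.
have : avg (fun x => aa e (restr e k) t x * B x * cutoff_prod k t x) <=
   eta * avg (fun x => bb e (restr e k) t x * B x * cutoff_prod k t x).
  rewrite /avg -wsumZ -!/(avg _); apply: avg_le => x.
  have B0 : 0 <= B x.
    by apply: prodr_ge0 => g _; have [/(_ t x) /andP[]] := b_rep g (k g).
  by have /(ler_wpM2l B0) := cutoff_prod_aa k x eT; lra.
rewrite /H /B; move: (avg _) (avg _) (avg _) (avg _) => p1 p2 p3 p4; lra.
Qed.

(** Each hue cut-off is at most [L * b], and the product of the [b] is the conditional expectation
    of the box. As [j < #|J|], every set in [levels] is proper. *)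
Lemma cutoff_le_box k : (j < #|J|)%N -> exists2 l, 0 < l & exists2 v, small v & forall t,
  avg (fun x => \prod_(e | proper e) cutoff k e t x) <=
  l * (avg (fun x => box k t x * cutoff_prod k t x) + v t).
Proof.
move=> jJ; have [_ _ _ /(_ _ (cutoff_prod01 k) (cutoff_prod_meas k)) sb] := cexp_box k.
exists (\prod_(g <- levels) L); first exact: prodr_gt0.
exists (fun t => -1 * avg (fun x =>
    (box k t x - \prod_(g <- levels) b g (k g) t x) * cutoff_prod k t x)).
  exact: smallZ sb.
move=> t.
have -> : avg (fun x => box k t x * cutoff_prod k t x) + -1 *
    avg (fun x => (box k t x - \prod_(g <- levels) b g (k g) t x) * cutoff_prod k t x) =
  avg (fun x => \prod_(g <- levels) b g (k g) t x * cutoff_prod k t x).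
  by rewrite /avg -wsumZ -wsumD; apply: eq_wsum => x; ring.
rewrite /avg -wsumZ -!/(avg _); apply: avg_le => x.
rewrite /cutoff big_split /= -/(cutoff_prod k t x) mulrC mulrA ler_wpM2r//.
  by have /andP[] := @cutoff_prod01 k t x.
rewrite -big_split /= -big_mkcondr /=.
rewrite (eq_bigl (fun e : {set J} => e \in (low j.+1 : pred {set J}))); last first.
  move=> e; rewrite inE; case: (ltnP #|e| j.+1); rewrite ?andbF ?andbT// => ej.
  by apply: contraTneq ej => ->; rewrite cardsT -leqNgt.
rewrite -big_enum /=; apply: ler_prod => g _.
have /andP[b0 _] : 0 <= b g (k g) t x <= 1 by have [/(_ t x)] := b_rep g (k g).
by have /andP[-> _] := @hue_cutoff01 g (k g) t x; rewrite cut_le.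
Qed.

(** Only the cell containing [x] contributes; the sum over all cells matches [cut_exceptional]. *)
Definition cell_loss e : ifun := fun t x => \sum_k cell e k t x * (1 - cell_cutoff e k t x).
Definition hue_loss g : ifun := fun t x => \sum_o hue g o t x * (1 - hue_cutoff g o t x).
Arguments cell_loss : clear implicits.
Arguments hue_loss : clear implicits.

Lemma cell_loss_avg e : exists2 v, small v & forall t,
  avg (cell_loss e t) <= (avg (z e t) + #|{: K}|%:R / L) / eta + v t.
Proof.
have A01 k : in01 (cell e k) by exact: cell01.
have Adep k : dep e (cell e k) by exact: cell_dep.
apply: (cut_exceptional (A := cell e) x0 L0 eta01 (z01 e) (@zdep e) A01 Adep _ (aa_rep e) (bb_rep e)).
by move=> t x; rewrite /cell sum_pred1_1.
Qed.

(** This is [cut_exceptional] with zero error, where only [L^-1] per colour remains. *)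
Lemma hue_loss_avg g : exists2 v, small v & forall t,
  avg (hue_loss g t) <= #|{: option (color c)}|%:R / L + v t.
Proof.
have A01 o : in01 (hue g o) by exact: hue01.
have Adep o : dep g (hue g o) by exact: hue_dep.
have one01 : 0 < (1 : R) <= 1 by rewrite ltr01 lexx.
have zz01 : in01 (fun t (_ : V t) => 0 : R) by move=> t x; rewrite lexx ler01.
have zzdep : dep g (fun t (_ : V t) => 0 : R) by [].
have zrep o : rep U g j (fun t x => 0 * hue g o t x) (fun t (_ : V t) => 0).
  by apply: rep0 => t x; rewrite mul0r.
have [|v sv Hv] := cut_exceptional (A := hue g) x0 L0 one01 zz01 zzdep A01 Adep _ zrep (b_rep g).
  by move=> t x; rewrite /hue sum_pred1_1.
exists v => // t; have := Hv t.
rewrite -/(hue_loss g) avg_cst ?(V_gt0 x0)// add0r divr1; exact.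
Qed.

Lemma cutoff_pointwise t (x : V t) e :
  1 - cutoff (key (low j.+1) c x) e t x <= cell_loss e t x + hue_loss e t x.
Proof.
rewrite /cell_loss /cell sum_pred1 key_restr /hue_loss /hue sum_pred1 /cutoff.
set k := key _ _ _.
have := @cell_cutoff01 e (restr e k) t x; have := @hue_cutoff01 e (Some (chi c e x)) t x.
case: ifP => [ej|_].
  have -> : k e = Some (chi c e x) by rewrite ffunE /low /= ej.
  by move: (cell_cutoff _ _ _ _) (hue_cutoff _ _ _ _) => p q; nra.
by move: (cell_cutoff _ _ _ _) (hue_cutoff _ _ _ _) => p q; lra.
Qed.

End Weights.
End Step.

(** * The induction on the level of measurability *)

Section Induction.
Context {R : realType} {J : finType} {X : nat -> finType}.
Context (U : set_system nat) {UF : UltraFilter U}.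
Hypothesis Uoo : forall N, \forall t \near U, (N <= t)%N.

Local Notation V t := {ffun J -> X t}.
Local Notation ifun := (forall t, V t -> R).
Local Notation small := (small (U := U)).
Local Notation proper := (fun e : {set J} => e != [set: J]%SET).

Variable x0 : forall t, V t.
Variable w : forall t, V t -> R.
Arguments w : clear implicits.
Hypothesis w_ge0 : forall t x, 0 <= w t x.
Hypothesis w_dom : forall e, e != [set: J]%SET -> forall phi : ifun,
  (forall t x, 0 <= phi t x) -> dep e phi -> forall t, wsum (w t) (phi t) <= avg (phi t).

Lemma near_le_small (P : pred {set J}) (F : {set J} -> nat -> R) (B : R) :
  (forall e, P e -> exists2 v, small v & forall t, F e t <= B + v t) ->
  forall d, 0 < d -> \forall t \near U, forall e, P e -> F e t <= B + d.
Proof.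
move=> H d d0; apply: near_forall_fin => e.
have [/H [v sv Hv]|_] := boolP (P e); last exact: filterE.
apply: filterS (sv _ d0) => t; rewrite ler_norml => /andP[_ vd] _.
by apply: le_trans (Hv t) _; rewrite lerD2l.
Qed.

(** Approximate each [W e] by a function [wh e] constant on cells.  Some box [k]
    with [wh e >= tau] on it has positive weight where the conditional error
    [aa] is at most [eta * bb] and where the hues have conditional probability
    bounded below; the induction hypothesis applies to these two conditions, and
    relative independence transports the result back to the box. *)
Lemma counts_step j : (j < #|J|)%N -> counts U w j -> counts U w j.+1.
Proof.
move=> jJ IH W W01 Wdep Wm [a' a'0 Ha'].
have Q0 : 0 < #|{set J}|%:R :> R by exact: card_sets_gt0.
have Q1 : 1 <= #|{set J}|%:R :> R by rewrite ler1n -(ltr0n R).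
set Q : R := #|{set J}|%:R in Q0 Q1.
have [a [a0 a1 Ha]] : exists a : R, [/\ 0 < a, a <= 1 & \forall t \near U,
    a <= wsum (w t) (fun x => \prod_(e | proper e) W e t x)].
  exists (Num.min a' 1); split; first by rewrite lt_min a'0 ltr01.
    by rewrite ge_min lexx orbT.
  by apply: filterS Ha' => t; apply: le_trans; rewrite ge_min lexx.
(* The constants give each error summed below at most [a / 8], apart from two terms of [a / 32]; in
   all [13 * a / 16], less than [a]. The choice of [eta] also makes [2 / tau * Q * eta] equal to
   [1 / 2] at the end. *)
have [tau [tau0 Qtau tau1]] : exists tau : R, [/\ 0 < tau, Q * tau = a / 8 & tau <= 1].
  exists (a / (8 * Q)); split.
  - by apply: divr_gt0 => //; lra.
  - by field; rewrite gt_eqF.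
  - by rewrite ler_pdivrMr; nra.
have [eta [eta0 Qeta eta1]] : exists eta : R, [/\ 0 < eta, 4 * Q * eta = tau & eta <= 1].
  exists (tau / (4 * Q)); split.
  - by apply: divr_gt0 => //; lra.
  - by field; rewrite gt_eqF.
  - by rewrite ler_pdivrMr; nra.
have eta01 : 0 < eta <= 1 by rewrite eta0.
have [d [d0 Qd]] : exists d : R, 0 < d /\ Q * d = a / 8 * eta.
  exists (a / (8 * Q) * eta); split; last by field; rewrite gt_eqF.
  by apply: mulr_gt0 => //; apply: divr_gt0; lra.
have /choice [cs Hcs] e : exists cs : @coloring J X * ifun,
    [/\ cellwise (below e j.+1) cs.1 cs.2, in01 cs.2 &
      \forall t \near U, avg (fun x => `|W e t x - cs.2 t x|) <= d].
  by have [c [s H]] := Wm e d d0; exists (c, s).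
pose c := join_coloring (fun e => (cs e).1); pose wh e := (cs e).2.
have wh_cell e : cellwise (below e j.+1) c (wh e).
  by have [? _ _] := Hcs e; exact: (@cellwise_join R J X _ (fun e => (cs e).1) _ e).
have wh01 e : in01 (wh e) by have [] := Hcs e.
pose z e : ifun := fun t x => `|W e t x - wh e t x|.
have z01 e : in01 (z e).
  move=> t x; rewrite normr_ge0 /=; have := W01 e t x; have := wh01 e t x.
  by rewrite ler_norml; lra.
have zdep e : dep e (z e).
  have whe : dep e (wh e).
    by apply: (@cellwise_dep _ _ _ (below e j.+1)) (wh_cell e) => g /andP[].
  by move=> t x y xy; rewrite /z (Wdep _ _ _ _ xy) (whe _ _ _ xy).
have z_avg : \forall t \near U, forall e, avg (z e t) <= d.
  by apply: near_forall_fin => e; have [_ _] := Hcs e.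
pose K : finType := {ffun {set J} -> option (color c)}.
have /choice [aa Haa] (p : {set J} * K) : exists aa,
    rep U p.1 j (fun t x => z p.1 t x * cell j p.1 p.2 x) aa.
  by apply: rep_exists => //; apply: in01_mul => //; exact: cell01.
have /choice [bb Hbb] (p : {set J} * K) : exists bb,
    rep U p.1 j (fun t x => cell (R := R) j p.1 p.2 (t := t) x) bb.
  by apply: rep_exists => //; exact: cell01.
have /choice [b Hb] (p : {set J} * option (color c)) : exists b,
    rep U p.1 j (fun t x => hue (R := R) p.1 p.2 (t := t) x) b.
  by apply: rep_exists => //; exact: hue01.
pose aa' e k := aa (e, k); pose bb' e k := bb (e, k); pose b' g o := b (g, o).
have aa_rep e k : rep U e j (fun t x => z e t x * cell j e k x) (aa' e k) by exact: Haa (e, k).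
have bb_rep e k : rep U e j (fun t x => cell (R := R) j e k (t := t) x) (bb' e k).
  exact: Hbb (e, k).
have b_rep g o : rep U g j (fun t x => hue (R := R) g o (t := t) x) (b' g o).
  exact: Hb (g, o).
have [L [L0 LK LC]] : exists L : R, [/\ 0 < L, Q * (#|K|%:R / L / eta) <= a / 8 &
    Q * (#|{: option (color c)}|%:R / L) <= a / 8].
  set k1 : R := #|K|%:R; set k2 : R := #|_|%:R.
  have k10 : 0 <= k1 by []. have k20 : 0 <= k2 by [].
  have Qe : 0 <= Q * (k1 / eta) by apply: mulr_ge0; [lra|apply: divr_ge0; lra].
  have Qk : 0 <= Q * k2 by nra.
  exists ((Q * (k1 / eta) + Q * k2 + 1) * (8 / a)).
  have L0 : 0 < (Q * (k1 / eta) + Q * k2 + 1) * (8 / a).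
    by apply: mulr_gt0; [lra|apply: divr_gt0; lra].
  have La : (Q * (k1 / eta) + Q * k2 + 1) * (8 / a) * (a / 8) = Q * (k1 / eta) + Q * k2 + 1.
    by rewrite -mulrA (_ : 8 / a * (a / 8) = 1) ?mulr1//; field; rewrite gt_eqF.
  split=> //.
    rewrite (_ : Q * (k1 / _ / eta) = Q * (k1 / eta) / ((Q * (k1 / eta) + Q * k2 + 1) * (8 / a))).
      by rewrite ler_pdivrMr// [leRHS]mulrC La; lra.
    by rewrite mulrAC !mulrA.
  by rewrite [Q * (k2 / _)]mulrA ler_pdivrMr// [leRHS]mulrC La; lra.
pose W' (k : K) := cutoff j aa' bb' b' L eta k.
(* [wh e] is constant on the box of [k], so a single point of the box decides this. *)
pose Gd (k : K) t := forall x : V t, (forall g : {set J}, (#|g| < j.+1)%N -> Some (chi c g x) = k g) ->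
  forall e, proper e -> tau <= wh e t x.
pose G (k : K) t : R := `[< Gd k t >]%:R.
have cutoff01' k e : in01 (W' k e) by exact: cutoff01.
have bad0 t (x : V t) e : 0 <= cell_loss j aa' bb' L eta e x + hue_loss b' L e x.
  rewrite addr_ge0//; apply: sumr_ge0 => k _; apply: mulr_ge0.
  - by have /andP[] := @cell01 R J X j c e k t x.
  - by rewrite subr_ge0; have /andP[] := @cell_cutoff01 R J X c aa' bb' L eta e k t x.
  - by have /andP[] := @hue01 R J X c e k t x.
  - by rewrite subr_ge0; have /andP[] := @hue_cutoff01 R J X c b' L e k t x.
have pointwise t (x : V t) : \prod_(e | proper e) W e t x <=
    \sum_(e | proper e) (tau + z e t x + (cell_loss j aa' bb' L eta e x + hue_loss b' L e x)) +
    \sum_k G k t * \prod_(e | proper e) W' k e t x.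
  have term0 e : 0 <= tau + z e t x + (cell_loss j aa' bb' L eta e x + hue_loss b' L e x).
    apply: addr_ge0 => //; apply: addr_ge0; first exact: ltW.
    by case/andP: (z01 e t x).
  have G0 k : 0 <= G k t * \prod_(e | proper e) W' k e t x.
    rewrite mulr_ge0//; apply: prodr_ge0 => e _; by have /andP[] := cutoff01' k e t x.
  (* Either some [wh e] is below [tau] at [x], and then [W e] is at most [tau + z e]; or the box
     containing [x] is good, and a union bound controls its missing cut-offs. *)
  have [/existsP[e /andP[eT lt_e]]|nex] := boolP [exists e, proper e && (wh e t x < tau)].
    apply: (@le_trans _ _ (tau + z e t x)).
      apply: (@le_trans _ _ (W e t x)).
        rewrite (bigD1 e)//= ler_piMr//; first by case/andP: (W01 e t x).
        by have /(_ t x) /andP[] := in01_prod (index_enum _) (fun i => proper i && (i != e)) W01.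
      have := ler_norm (W e t x - wh e t x); rewrite -/(z e t x); lra.
    rewrite (bigD1 e)//= -!addrA.
    have S1 : 0 <= \sum_(i | proper i && (i != e))
      (tau + z i t x + (cell_loss j aa' bb' L eta i x + hue_loss b' L i x)).
      by apply: sumr_ge0.
    have S2 : 0 <= \sum_k G k t * \prod_(i | proper i) W' k i t x by apply: sumr_ge0.
    have := bad0 t x e; lra.
  pose k : K := key (low j.+1) c x.
  have Gk : Gd k t.
    move=> y Hy e eT.
    have -> : wh e t y = wh e t x.
      apply: wh_cell; apply/key_eqP => g /andP[_ gj].
      have := Hy g gj; rewrite /k ffunE /low /= gj; by case.
    by move: nex; rewrite negb_exists => /forallP /(_ e); rewrite eT -leNgt.
  have : 1 - \prod_(e | proper e) W' k e t x <= \sum_(e | proper e) (1 - W' k e t x).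
    by apply: one_sub_prod => e; exact: cutoff01'.
  have : \sum_(e | proper e) (1 - W' k e t x) <= \sum_(e | proper e)
      (tau + z e t x + (cell_loss j aa' bb' L eta e x + hue_loss b' L e x)).
    apply: ler_sum => e _; apply: le_trans (cutoff_pointwise j aa' bb' b' L eta x e) _.
    rewrite lerDr; apply: addr_ge0; first exact: ltW.
    by case/andP: (z01 e t x).
  have : \prod_(e | proper e) W' k e t x <= \sum_k G k t * \prod_(e | proper e) W' k e t x.
    rewrite (bigD1 k)//= /G asboolT// mul1r lerDl; apply: sumr_ge0 => i _; exact: G0.
  have /(_ t x) /andP[_] := in01_prod (index_enum _) proper W01.
  lra.
have K0 : 0 < #|K|%:R :> R.
  rewrite ltr0n; apply/card_gt0P; by exists (key (low j.+1) c (x0 0)).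
have [k Hk] : exists k : K, \forall t \near U, Gd k t /\ a / (8 * #|K|%:R) <=
    wsum (w t) (fun x => \prod_(e | proper e) W' k e t x).
  apply: ultra_exists_fin.
  pose er := a / (32 * Q).
  have er0 : 0 < er by apply: divr_gt0 => //; lra.
  have Qer : Q * er = a / 32 by rewrite /er; field; rewrite gt_eqF.
  have nearU := near_le_small (P := proper)
    (F := fun e t => avg (fun x => cell_loss j aa' bb' L eta e (t := t) x) - avg (z e t) / eta)
    (B := #|K|%:R / L / eta) _ er0.
  have nearY := near_le_small (P := proper)
    (F := fun e t => avg (fun x => hue_loss b' L e (t := t) x))
    (B := #|{: option (color c)}|%:R / L) _ er0.
  have {}nearU : \forall t \near U, forall e, proper e ->
      avg (fun x => cell_loss j aa' bb' L eta e (t := t) x) - avg (z e t) / eta <=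
      #|K|%:R / L / eta + er.
    apply: nearU => e _; have [v sv Hv] := cell_loss_avg x0 z01 zdep aa_rep bb_rep L0 eta01 e.
    exists v => // t; have := Hv t; rewrite mulrDl; lra.
  have {}nearY : \forall t \near U, forall e, proper e ->
      avg (fun x => hue_loss b' L e (t := t) x) <= #|{: option (color c)}|%:R / L + er.
    apply: nearY => e _; have [v sv Hv] := hue_loss_avg x0 b_rep L0 e.
    by exists v.
  have nearUY : \forall t \near U, (forall e, proper e ->
      avg (fun x => cell_loss j aa' bb' L eta e (t := t) x) - avg (z e t) / eta <=
      #|K|%:R / L / eta + er) /\ (forall e, proper e ->
      avg (fun x => hue_loss b' L e (t := t) x) <= #|{: option (color c)}|%:R / L + er).
    by apply: filterS2 nearU nearY.
  apply: filterS3 nearUY z_avg Ha => t [HU HY] Hz Hat.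
  apply: contrapT => nex.
  have sumG : \sum_(k : K) G k t * wsum (w t) (fun x => \prod_(e | proper e) W' k e t x) <= a / 8.
    rewrite [leRHS](_ : _ = #|K|%:R * (a / (8 * #|K|%:R))); last first.
      by field; rewrite gt_eqF.
    apply: sum_le_card => [|k _]; first by apply: divr_ge0; lra.
    rewrite /G; case: asboolP => [Gk|_]; last by rewrite mul0r; apply: divr_ge0; lra.
    rewrite mul1r leNgt; apply/negP => /ltW lt_k; apply: nex; exists k.
    by split.
  have sumE e : proper e -> wsum (w t) (fun x =>
      tau + z e t x + (cell_loss j aa' bb' L eta e x + hue_loss b' L e x)) <=
      tau + d + ((d / eta + #|K|%:R / L / eta + er) + (#|{: option (color c)}|%:R / L + er)).
    move=> eT.
    have term0 u (x : V u) : 0 <= tau + z e u x + (cell_loss j aa' bb' L eta e x + hue_loss b' L e x).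
      apply: addr_ge0; first by apply: addr_ge0; [exact: ltW|case/andP: (z01 e u x)].
      exact: bad0.
    have dep_term : dep e (fun u (x : V u) =>
        tau + z e u x + (cell_loss j aa' bb' L eta e x + hue_loss b' L e x)).
      move=> u x y xy; rewrite (zdep _ _ _ _ xy) /cell_loss /hue_loss /cell_cutoff /hue_cutoff.
      congr (_ + (_ + _)); apply: eq_bigr => k _.
        have [_ ae _ _] := aa_rep e k; have [_ be _ _] := bb_rep e k.
        by rewrite (ae _ _ _ xy) (be _ _ _ xy) (@cell_dep R J X j c e k u x y xy).
      by have [_ be _ _] := b_rep e k; rewrite (be _ _ _ xy) (@hue_dep R J X c e k u x y xy).
    (* Each error depends on the coordinates in one proper set only, so its mass under [w] is
       bounded by its uniform average. *)
    apply: le_trans (w_dom eT term0 dep_term t) _.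
    rewrite /avg !wsumD -!/(avg _) avg_cst ?(V_gt0 x0)//.
    have zd : avg (z e t) / eta <= d / eta by rewrite ler_pM2r ?invr_gt0.
    have := HU e eT; have := HY e eT; have := Hz e; lra.
  have : a <= Q * (tau + d + ((d / eta + #|K|%:R / L / eta + er) +
      (#|{: option (color c)}|%:R / L + er))) + a / 8.
    apply: le_trans Hat _; apply: le_trans (wsum_le (@w_ge0 t) (pointwise t)) _.
    rewrite wsumD !wsum_sum; apply: lerD.
      have h1 : 0 <= d / eta by apply: divr_ge0; exact: ltW.
      have h2 : 0 <= #|K|%:R / L / eta.
        by apply: divr_ge0; [apply: divr_ge0 => //|]; exact: ltW.
      have h3 : 0 <= #|{: option (color c)}|%:R / L by apply: divr_ge0 => //; exact: ltW.
      by apply: sum_le_card sumE; lra.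
    apply: le_trans sumG; apply: ler_sum => k _.
    by rewrite wsumZ.
  have Qd1 : Q * d <= a / 8 by rewrite Qd; nra.
  have Qde : Q * (d / eta) = a / 8 by rewrite mulrA Qd mulfK ?gt_eqF.
  move: LK LC Qtau Qer; rewrite !mulrDr Qde; lra.
have [a2 a20 Ha2] : pos U (fun t => avg (fun x => \prod_(e | proper e) W' k e t x)).
  apply: IH => [e|e|e|].
  - exact: cutoff01'.
  - exact: cutoff_dep aa_rep bb_rep b_rep _ _ k e.
  - exact: (cutoff_meas (UF := UF) aa_rep bb_rep b_rep L0 eta01 k e).
  exists (a / (8 * #|K|%:R)); first by apply: divr_gt0 => //; lra.
  by apply: filterS Hk => t [].
pose bs t x : R := box j k (t := t) x * cutoff_prod j aa' bb' L eta k x.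
have bs01 t x : 0 <= bs t x <= 1.
  apply: (in01_mul (phi := fun t x => box j k (t := t) x)); last exact: cutoff_prod01.
  by apply: in01_prod => g; exact: hue01.
have [l l0 [v sv Hv]] := cutoff_le_box x0 aa_rep bb_rep b_rep L0 eta01 k jJ.
(* Once [v] is at most [be], [cutoff_le_box] gives [bs] average at least [be]. The errors then
   remove half of that average and a further [be / 4], so at least [be / 4] survives. *)
pose be := a2 / (2 * l).
have be0 : 0 < be by apply: divr_gt0 => //; lra.
have lbe : l * be = a2 / 2 by rewrite /be; field; rewrite gt_eqF.
pose er := be * tau / (8 * Q).
have er0 : 0 < er by apply: divr_gt0; [exact: mulr_gt0|lra].
have Qer : 2 / tau * (Q * er) = be / 4 by rewrite /er; field; rewrite !gt_eqF.
have near_defect : \forall t \near U, forall e, proper e ->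
    avg (fun x => z e t x * bs t x) - eta * avg (bs t) <= 0 + er.
  apply: near_le_small er0 => e eT.
  have [u su Hu] := box_defect x0 z01 zdep aa_rep bb_rep b_rep L0 eta01 k eT.
  by exists u => // t; have := Hu t; rewrite -!/(bs _ _); lra.
pose k0 := \prod_(e | proper e) (tau / 2).
have k00 : 0 < k0 by apply: prodr_gt0 => e _; lra.
exists (k0 * (be / 4)); first by apply: mulr_gt0 => //; lra.
have nearA : \forall t \near U, `|v t| <= be /\ Gd k t.
  by apply: filterS2 (sv _ be0) Hk => t ? [].
apply: filterS3 nearA Ha2 near_defect => t [Hvt Gkt] Hat Hdt.
have be_le : be <= avg (bs t).
  have := le_trans Hat (Hv t); rewrite -/(avg (bs t)) => h.
  have : l * (2 * be) <= l * (avg (bs t) + v t) by rewrite mulrCA lbe; lra.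
  by rewrite ler_pM2l//; move: Hvt; rewrite ler_norml; lra.
apply: (@le_trans _ _ (avg (fun x => k0 * (bs t x +
    (- (2 / tau)) * \sum_(e | proper e) z e t x * bs t x)))); last first.
  apply: avg_le => x.
  have W0 : 0 <= \prod_(e | proper e) W e t x.
    by apply: prodr_ge0 => e _; case/andP: (W01 e t x).
  have [b0|b0] := eqVneq (box (R := R) j k x) 0.
    have bs0 : bs t x = 0 by rewrite /bs b0 mul0r.
    by rewrite bs0 add0r big1 ?mulr0// => e _; rewrite mulr0.
  have := prod_lower tau0 (fun e _ => proj1 (andP (W01 e t x))) (fun e eT => Gkt x (key_box b0) e eT).
  rewrite -/k0 -mulr_sumr -mulr_suml => h.
  rewrite [leLHS](_ : _ = k0 * (1 - 2 / tau * \sum_(e | proper e) z e t x) * bs t x); last by ring.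
  move: h; rewrite -/(z _ t x); move: (k0 * _) (bs01 t x) => m /andP[bs0 bs1] mW.
  have [m0|m0] := leP 0 m; first by apply: le_trans mW; rewrite ler_piMr.
  by apply: le_trans W0; rewrite mulr_le0_ge0// ltW.
rewrite /avg wsumZ wsumD wsumZ wsum_sum -!/(avg _) ler_pM2l//.
have : \sum_(e | proper e) avg (fun x => z e t x * bs t x) <= Q * (eta * avg (bs t) + er).
  apply: sum_le_card => [|e /Hdt]; last by lra.
  by rewrite addr_ge0// ?(ltW er0)// mulr_ge0// ?(ltW eta0)//; lra.
have tau20 : 0 < 2 / tau by rewrite divr_gt0.
move=> /(ler_wpM2l (ltW tau20)); rewrite (mulrDr Q) (mulrDr (2 / tau)) Qer.
have -> : 2 / tau * (Q * (eta * avg (bs t))) = avg (bs t) / 2.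
  by rewrite -Qeta; field; rewrite !gt_eqF.
rewrite mulNr; lra.
Qed.

End Induction.

(** * Simplex counting for indicators *)

Section SimplexCounting.
Context {R : realType} {J : finType} {X : nat -> finType}.
Context (U : set_system nat) {UF : UltraFilter U}.
Hypothesis Uoo : forall N, \forall t \near U, (N <= t)%N.

Local Notation V t := {ffun J -> X t}.
Local Notation ifun := (forall t, V t -> R).
Local Notation proper := (fun e : {set J} => e != [set: J]%SET).

Variable x0 : forall t, V t.
Variable w : forall t, V t -> R.
Arguments w : clear implicits.
Hypothesis w_ge0 : forall t x, 0 <= w t x.
Hypothesis w_dom : forall e, e != [set: J]%SET -> forall phi : ifun,
  (forall t x, 0 <= phi t x) -> dep e phi -> forall t, wsum (w t) (phi t) <= avg (phi t).

Lemma counts_all j : (j <= #|J|)%N -> counts U w j.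
Proof.
elim: j => [_|j IH jJ]; first exact: (counts0 x0 w_ge0 w_dom).
exact: (counts_step Uoo x0 w_ge0 w_dom jJ (IH (ltnW jJ))).
Qed.

(** The [A e] themselves form a coloring, and a proper [e] has fewer than [#|J|] elements, so the
    indicators are measurable at level [#|J|]. *)
Lemma simplex_counting (A : {set J} -> forall t, V t -> bool) :
  (forall e, dep e (A e)) ->
  pos U (fun t => wsum (w t) (fun x => \prod_(e | proper e) (A e t x)%:R)) ->
  pos U (fun t => avg (fun x => \prod_(e | proper e) (A e t x)%:R : R)).
Proof.
move=> Adep [a' a'0 Ha']; pose c := Coloring Adep.
(* The full set is given the value 1, as [A] there need not be measurable at this level; the
   products skip it. *)
pose W e : ifun := fun t x => if proper e then (A e t x)%:R else 1.
have W01 e : in01 (W e).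
  move=> t x; rewrite /W; case: ifP => _; last by rewrite ler01 lexx.
  exact: (@in01_bool R J X (A e) t x).
have WE t (x : V t) : \prod_(e | proper e) W e t x = \prod_(e | proper e) (A e t x)%:R.
  by apply: eq_bigr => e eT; rewrite /W eT.
have := @counts_all #|J| (leqnn _) W W01; case=> //.
- move=> e t x y xy; rewrite /W; case: ifP => // _.
  by rewrite (Adep e t x y xy).
- move=> e; apply: (@cellwise_meas _ _ _ U _ _ c) => // t x y /key_eqP xy; rewrite /W.
  case: ifP => // eT; rewrite (_ : A e t x = A e t y)//; apply: (xy e).
  by rewrite /below /= subxx -cardsT proper_card// properT.
- exists a' => //; apply: filterS Ha' => t.
  by under eq_wsum => x do rewrite -WE.
by move=> a a0 Ha; exists a => //; apply: filterS Ha => t; under eq_avg => x do rewrite WE.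
Qed.

End SimplexCounting.

(** * The extremal bound *)

Unset Implicit Arguments.

Theorem theorem1 (R : realType) (r k e : nat)
    (hrk : (k + 1 <= r)%N) (hke : (e <= k + 1)%N) (he : (3 <= e)%N) :
  (fun n : nat => (ex_edges r n (e * (r - k) + k + 1)%N e)%:R : R)
    =o_\oo (fun n : nat => n%:R ^+ k : R).
Proof.
have kr : (k < r)%N by rewrite -addn1.
have ek : (e <= k.+1)%N by rewrite -addn1.
have e0 : (0 < e)%N by exact: leq_trans he.
set v := (e * (r - k) + k + 1)%N.
apply/eqoP => eps eps0.
(* Moving to [n.+1] makes the vertex set inhabited. *)
have shift (P : nat -> Prop) : (\forall n \near \oo, P n.+1) -> \forall n \near \oo, P n.
  by case=> N _ HN; exists N.+1 => // -[//|n] /HN.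
apply: shift; apply: contrapT => often.
(* By [often], [S] meets every neighbourhood of infinity, so some ultrafilter finer than [\oo]
   contains it. *)
pose S : set nat := [set n | ~ `|(ex_edges r n.+1 v e)%:R : R| <= eps * `|n.+1%:R ^+ k : R|].
have FS : ProperFilter (within S \oo).
  apply: Build_ProperFilter_ex => P HP; apply: contrapT => noP; apply: often.
  have {}HP : \forall n \near \oo, S n -> P n := HP.
  apply: filterS HP => n Pn; apply: contrapT => Sn.
  by apply: noP; exists n; exact: Pn.
have [U [cell_cutoff FU]] := ultraFilterLemma FS.
have US : \forall t \near U, S t by apply: FU; rewrite /within; exact: nearW.
have Uoo N : \forall t \near U, (N <= t)%N.
  by apply: FU; exists N => // t /= Nt _.
have ext n : exists H : {set {set 'I_n.+1}},
    [/\ uniform r H, Gfree v e H & #|H| = ex_edges r n.+1 v e].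
  pose adm := [pred H : {set {set 'I_n.+1}} | uniform r H && Gfree v e H].
  have adm0 : (0 < #|adm|)%N.
    apply/card_gt0P; exists finset.set0; rewrite inE; apply/andP; split.
      by apply/forall_inP => E; rewrite inE.
    apply/negP => /existsP[T /and3P[]]; rewrite finset.subset0 => /eqP->.
    by rewrite cards0 => /eqP h; move: e0; rewrite -h.
  have [H /andP[Hu Hf] HE] := eq_bigmax_cond (fun H : {set {set 'I_n.+1}} => #|H|) adm0.
  by exists H; split=> //; rewrite -HE.
pose H n := sval (cid (ext n)).
have HH n : [/\ uniform r (H n), Gfree v e (H n) & #|H n| = ex_edges r n.+1 v e] :=
  svalP (cid (ext n)).
have Hu n : uniform r (H n) by case: (HH n).
have Hf n : Gfree v e (H n) by case: (HH n).
pose w n : {ffun 'I_k.+1 -> 'I_n.+1} -> R := edge_weight e (H n).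
pose A (s : {set 'I_k.+1}) n (x : {ffun 'I_k.+1 -> 'I_n.+1}) := face (H n) s x.
pose x0 n : {ffun 'I_k.+1 -> 'I_n.+1} := [ffun=> ord0].
have w_ge0 n (x : {ffun 'I_k.+1 -> 'I_n.+1}) : 0 <= w n x by exact: edge_weight_ge0.
have w_dom s : s != [set: 'I_k.+1]%SET ->
    forall phi : (forall n, {ffun 'I_k.+1 -> 'I_n.+1} -> R),
    (forall n x, 0 <= phi n x) -> dep s phi -> forall n, wsum (w n) (phi n) <= avg (phi n).
  move=> sT phi phi0 phis n.
  by apply: (edge_weight_dom kr e0 (Hu n) (Hf n) sT) => //; exact: phis.
have A_dep s : dep s (A s) by move=> n x y; exact: face_dep.
have denom0 n : 0 < e%:R * n.+1%:R ^+ k :> R by exact: denom_gt0.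
(* The point of an edge has all its faces, so the mass of such points is [#|H n|] over
   [e * n.+1 ^ k], which exceeds [eps / e] on [S]. *)
have [|a a0 Ha] := simplex_counting Uoo x0 w_ge0 w_dom A_dep.
  exists (eps / e%:R); first by rewrite divr_gt0 ?ltr0n.
  apply: filterS US => n; rewrite /S /= => /negP; rewrite -ltNge => lt_n.
  rewrite wsum_edge_weight.
  have -> : \sum_(E in H n) \prod_(s | s != [set: 'I_k.+1]%SET) (A s n (tup k E))%:R = #|H n|%:R :> R.
    rewrite -sum1_card natr_sum; apply: eq_bigr => E EH.
    by rewrite big1// => s _; rewrite /A face_tup.
  have [_ _ ->] := HH n.
  rewrite ler_pdivlMr ?denom0// mulrA divfK ?pnatr_eq0 -?lt0n//.
  by move: lt_n; rewrite !ger0_norm ?exprn_ge0// => /ltW.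
have small_avg n : avg (fun x => \prod_(s | s != [set: 'I_k.+1]%SET) (A s n x)%:R : R) <=
    e%:R * r%:R ^+ k.+1 / n.+1%:R.
  apply: (@le_trans _ _ (avg (fun x : {ffun 'I_k.+1 -> 'I_n.+1} => (degenerate (H n) x)%:R))).
    apply: avg_le => x; have [dx|ndx] := boolP (degenerate (H n) x).
      have A01 s : in01 (R := R) (fun n (x : {ffun 'I_k.+1 -> 'I_n.+1}) => (A s n x)%:R).
        exact: in01_bool.
      by have /(_ n x) /andP[] :=
        in01_prod (index_enum _) (fun s : {set 'I_k.+1} => s != [set: 'I_k.+1]%SET) A01.
    have [s sT ns] : exists2 s : {set 'I_k.+1}, s != [set: 'I_k.+1]%SET & ~~ face (H n) s x.
      apply: contrapT => nex; move/negP: ndx; apply.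
      apply: (no_simplex kr ek (Hu n) (Hf n)) => s sT.
      by apply: contrapT => /negP ns; apply: nex; exists s.
    by rewrite (bigD1 s)//= /A (negbTE ns) mul0r.
  (* Domination tested on the constant 1 gives the trivial bound of order [n ^ k]. *)
  have cardH : #|H n|%:R <= e%:R * n.+1%:R ^+ k :> R.
    have := edge_weight_dom (R := R) kr e0 (Hu n) (Hf n) (s := finset.set0) (f := fun=> 1).
    rewrite wsum_edge_weight sumr_const avg_cst ?ler_pdivrMr ?mul1r//; last first.
      by apply/card_gt0P; exists (x0 n).
    apply=> //; apply/negP => /eqP/setP /(_ ord0); by rewrite !inE.
  rewrite avgE card_ffun !card_ord natrX mulrC ler_pdivrMr ?exprn_gt0//.
  rewrite -natr_sum.
  have -> : (\sum_(x : {ffun 'I_k.+1 -> 'I_n.+1}) degenerate (H n) x =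
      #|[set x : {ffun 'I_k.+1 -> 'I_n.+1} | degenerate (H n) x]%SET|)%N.
    by rewrite -sum1_card [RHS]big_mkcond /=; apply: eq_bigr => x _; rewrite inE; case: degenerate.
  apply: (@le_trans _ _ (#|H n|%:R * r%:R ^+ k.+1)).
    by rewrite -natrX -natrM ler_nat; exact: card_degenerate (Hu n).
  rewrite [leRHS](_ : _ = e%:R * n.+1%:R ^+ k * r%:R ^+ k.+1) ?ler_wpM2r ?exprn_ge0//.
  have N0 : n.+1%:R != 0 :> R by rewrite pnatr_eq0.
  move: N0; rewrite [n.+1%:R ^+ k.+1]exprS; move: (n.+1%:R : R) => N N0; field.
  exact: N0.
(* From [N] on, the upper bound in [small_avg] is smaller than [a]. *)
pose N := (Num.truncn (e%:R * r%:R ^+ k.+1 / a)).+1.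
have [n [Hn Nn]] := filter_ex (filterI Ha (Uoo N)).
have := le_trans Hn (small_avg n); rewrite leNgt => /negP; apply.
rewrite ltr_pdivrMr ?ltr0n// -ltr_pdivrMl// mulrC.
apply: lt_le_trans (truncnS_gt _) _; rewrite ler_nat.
exact: leq_trans Nn (leqnSn n).
Qed.
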